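(* Let $\mathfrak{g}_{4|2}^{2}(\lambda)$ ($\lambda\in\mathbb{C}$, $\lambda\neq0$) and $\mathfrak{g}_{4|2}^{3}$ be the complex Lie superalgebras of dimension $4|2$ with basis $\{e_1,e_2,e_3,e_4\mid e_5,e_6\}$ ($e_1,\dots,e_4$ even, $e_5,e_6$ odd) and nontrivial brackets \begin{align*} \mathfrak{g}_{4|2}^{2}(\lambda):\ &[e_1,e_2]=e_2,\ [e_1,e_3]=-e_3,\ [e_2,e_3]=e_4,\ [e_1,e_5]=\lambda e_5,\ [e_1,e_6]=-\lambda e_6,\ [e_5,e_6]=\lambda e_4;\\ \mathfrak{g}_{4|2}^{3}:\ &[e_1,e_2]=e_2,\ [e_1,e_3]=-e_3,\ [e_2,e_3]=e_4,\ [e_1,e_5]=\tfrac12e_5,\ [e_1,e_6]=-\tfrac12e_6,\\ &[e_2,e_6]=e_5,\ [e_5,e_6]=\tfrac12e_4,\ [e_6,e_6]=e_3. \end{align*} Metric deformations of the family $\mathfrak{g}_{4|2}^{2}(\lambda)$ $(\lambda\neq0)$ follow two different patterns: (1) If $\lambda\neq\pm\frac12$, then $\mathfrak{g}_{4|2}^{2}(\lambda)$ has one (nontrivial) metric deformation, up to equivalence and change of parameter, and it is a smooth metric deformation to the family $\mathfrak{g}_{4|2}^{2}(\lambda)$ around itself. (2) The special element $\mathfrak{g}_{4|2}^{2}(\frac12)\cong\mathfrak{g}_{4|2}^{2}(-\frac12)$ has a smooth metric deformation to the family $\mathfrak{g}_{4|2}^{2}(\lambda)$ around itself, and it has jump metric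 deformations to $\mathfrak{g}_{4|2}^{3}$ and to $\mathfrak{osp}(1,2)\oplus\mathbb{C}_{1|0}$.
   Context: All Lie superalgebras are over $\mathbb{C}$. Brackets of basis elements that are not listed are zero or determined by $[y,x]=-(-1)^{|x||y|}[x,y]$. $\mathbb{C}_{m|n}$ is the abelian Lie superalgebra of dimension $m|n$. $\mathfrak{osp}(1,2)$ is the $3|2$-dimensional Lie superalgebra with basis $\{e_1,e_2,e_3\mid e_4,e_5\}$ and nontrivial brackets $[e_1,e_2]=e_3$, $[e_1,e_3]=-2e_1$, $[e_2,e_3]=2e_2$, $[e_1,e_5]=-e_4$, $[e_2,e_4]=-e_5$, $[e_3,e_4]=e_4$, $[e_3,e_5]=-e_5$, $[e_4,e_4]=\frac12e_1$, $[e_4,e_5]=\frac14e_3$, $[e_5,e_5]=-\frac12e_2$. A metric Lie superalgebra is a Lie superalgebra together with an even, non-degenerate, supersymmetric bilinear form $B$ that is invariant: $B([x,y],z)=B(x,[y,z])$. A formal 1-parameter deformation of a Lie superalgebra $(\mathfrak g,[\ ,\ ])$ is a $\mathbb{C}[[t]]$-bilinear Lie superalgebra structure on $\mathfrak g[[t]]=\mathfrak g\otimes_{\mathbb C}\mathbb{C}[[t]]$ of the form $[\ ,\ ]_t=[\ ,\ ]+\sum_{i\ge1}t^i\phi_i$, each $\phi_i:\mathfrak g\times\mathfrak g\to\mathfrak g$ being an even super-skew-symmetric bilinear map. Two such deformations $[\ ,\ ]_t,[\ ,\ ]'_t$ are equivalent if there is $\widehat\psi_t=\mathrm{id}+\psi_1t+\psi_2t^2+\cdots$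 with even linear $\psi_i:\mathfrak g\to\mathfrak g$ and $\widehat\psi_t([x,y]_t)=[\widehat\psi_t(x),\widehat\psi_t(y)]'_t$ for all $x,y\in\mathfrak g$. A deformation is trivial if it is equivalent to the original bracket. A metric deformation is a formal 1-parameter deformation that defines a metric Lie superalgebra, i.e. $(\mathfrak g[[t]],[\ ,\ ]_t)$ admits an even, supersymmetric, invariant $\mathbb{C}[[t]]$-bilinear form that is non-degenerate over $\mathbb{C}[[t]]$ (induces an isomorphism with the dual module). A deformation is a jump deformation to $\mathfrak h$ if for every non-zero value of $t$ near the origin it gives an algebra isomorphic to the same Lie superalgebra $\mathfrak h$, which is not isomorphic to $\mathfrak g$. It is smooth if for different non-zero values of $t$ near the origin it defines non-isomorphic algebras (coincidences caused by symmetry being allowed). It is a smooth deformation to a family $\mathfrak h(\lambda)$ around $\lambda_0$ (around itself, if $\mathfrak g=\mathfrak h(\lambda_0)$) if it is smooth and for non-zero $t$ near the origin it is isomorphic to $\mathfrak h(\lambda(t))$ with $\lambda(t)\to\lambda_0$ as $t\to0$. *)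

(* Defs.v *)
From HB Require Import structures.
From mathcomp Require Import all_boot all_order all_algebra.
From mathcomp Require Import all_classical all_reals all_analysis.

Set Implicit Arguments.
Unset Strict Implicit.
Unset Printing Implicit Defensive.

Import Order.TTheory GRing.Theory Num.Theory.
Import numFieldNormedType.Exports.
Local Open Scope classical_set_scope.
Local Open Scope ring_scope.

(** * Formal power series *)

Record fps (K : Type) := Fps { fps_coef :> nat -> K }.

Lemma fpsP (K : Type) (f g : fps K) : f =1 g -> f = g.
Proof. by case: f g => f [g] /= /funext ->. Qed.

HB.instance Definition _ (K : Type) := gen_eqMixin (fps K).
HB.instance Definition _ (K : Type) := gen_choiceMixin (fps K).

Section FpsRing.
Variable K : comNzRingType.
Implicit Types f g h : fps K.

Definition fps_const (c : K) : fps K := Fps (fun n => if n is 0%N then c else 0).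
Definition fps_add f g : fps K := Fps (fun n => f n + g n).
Definition fps_opp f : fps K := Fps (fun n => - f n).
Definition fps_mul f g : fps K :=
  Fps (fun n => \sum_(i < n.+1) f i * g (n - i)%N).

Fact fps_addA : associative fps_add.
Proof. by move=> f g h; apply: fpsP => n /=; rewrite addrA. Qed.
Fact fps_addC : commutative fps_add.
Proof. by move=> f g; apply: fpsP => n /=; rewrite addrC. Qed.
Fact fps_add0 : left_id (fps_const 0) fps_add.
Proof. by move=> f; apply: fpsP => -[|n] /=; rewrite add0r. Qed.
Fact fps_addN : left_inverse (fps_const 0) fps_opp fps_add.
Proof. by move=> f; apply: fpsP => -[|n] /=; rewrite addNr. Qed.

HB.instance Definition _ :=
  GRing.isZmodule.Build (fps K) fps_addA fps_addC fps_add0 fps_addN.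

Let trunc m f : {poly K} := \poly_(i < m.+1) f i.

Let fps_mul_trunc m n f g :
  (n <= m)%N -> fps_mul f g n = (trunc m f * trunc m g)`_n.
Proof.
move=> le_nm; rewrite coefM; apply: eq_bigr => i _.
rewrite !coef_poly !ltnS (leq_trans (leq_ord i) le_nm).
by rewrite (leq_trans (leq_subr i n) le_nm).
Qed.

Fact fps_mulC : commutative fps_mul.
Proof.
by move=> f g; apply: fpsP => n; rewrite !(fps_mul_trunc _ _ (leqnn n)) mulrC.
Qed.

Fact fps_mulA : associative fps_mul.
Proof.
move=> f g h; apply: fpsP => n.
transitivity ((trunc n f * (trunc n g * trunc n h))`_n).
  rewrite coefM; apply: eq_bigr => i _; rewrite coef_poly ltnS leq_ord.
  by rewrite (fps_mul_trunc _ _ (leq_subr i n)).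
rewrite mulrA coefM; apply: eq_bigr => i _.
by rewrite (fps_mul_trunc _ _ (leq_ord i)) coef_poly ltnS leq_subr.
Qed.

Fact fps_mul1 : left_id (fps_const 1) fps_mul.
Proof.
move=> f; apply: fpsP => n /=; rewrite big_ord_recl /= mul1r subn0.
by rewrite big1 ?addr0 // => i _; rewrite /= mul0r.
Qed.

Fact fps_mulDl : left_distributive fps_mul fps_add.
Proof.
move=> f g h; apply: fpsP => n /=; rewrite -big_split /=.
by apply: eq_bigr => i _; rewrite mulrDl.
Qed.

Fact fps_1neq0 : fps_const 1 != 0.
Proof.
by apply/eqP => /(congr1 (fun f : fps K => f 0%N)) /eqP; rewrite (oner_eq0 K).
Qed.

HB.instance Definition _ := GRing.Zmodule_isComNzRing.Build (fps K)
  fps_mulA fps_mulC fps_mul1 fps_mulDl fps_1neq0.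

(* f(s(t)); only meaningful when s has no constant term, since the powers
   s ^+ k with k > n then do not contribute to the coefficient of t^n. *)
Definition fps_comp (f s : fps K) : fps K :=
  Fps (fun n => \sum_(k < n.+1) f k * (s ^+ k) n).

End FpsRing.

(** * Lie superalgebras on free modules of rank m|n *)

(* The free K-supermodule of dimension m|n is 'rV[K]_(m + n); the first m
   coordinates are even, the last n are odd. *)
Definition bracket (K : Type) (m n : nat) :=
  'rV[K]_(m + n) -> 'rV[K]_(m + n) -> 'rV[K]_(m + n).

Section LieSuper.
Variable K : comNzRingType.

(* x is homogeneous of parity p (true is odd); 0 has both parities. *)
Definition homog m n (p : bool) (x : 'rV[K]_(m + n)) : Prop :=
  if p then lsubmx x = 0 else rsubmx x = 0.

Record is_lie_super m n (br : bracket K m n) : Prop := IsLieSuper {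
  lie_linearr : forall x, linear (br x);
  lie_linearl : forall y, linear (br^~ y);
  lie_even : forall p q x y,
    homog p x -> homog q y -> homog (p (+) q) (br x y);
  lie_skew : forall p q x y, homog p x -> homog q y ->
    br y x = - ((-1) ^+ (p && q) *: br x y);
  lie_jacobi : forall p q r x y z,
    homog p x -> homog q y -> homog r z ->
    br x (br y z) = br (br x y) z + (-1) ^+ (p && q) *: br y (br x z)
}.

Definition lie_iso m n m' n' (br : bracket K m n) (br' : bracket K m' n') : Prop :=
  exists f : {linear 'rV[K]_(m + n) -> 'rV[K]_(m' + n')},
    [/\ bijective f,
        forall p x, homog p x -> homog p (f x)
      & forall x y, f (br x y) = br' (f x) (f y)].

(* The last field says that x |-> B(x, -) is a bijection onto the dual. *)
Record is_metric_form m n (br : bracket K m n)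
    (B : 'rV[K]_(m + n) -> 'rV[K]_(m + n) -> K) : Prop := IsMetricForm {
  metric_linearr : forall x, scalar (B x);
  metric_linearl : forall y, scalar (B^~ y);
  metric_even : forall p q x y, homog p x -> homog q y -> p != q -> B x y = 0;
  metric_supersym : forall p q x y, homog p x -> homog q y ->
    B y x = (-1) ^+ (p && q) * B x y;
  metric_invariant : forall x y z, B (br x y) z = B x (br y z);
  metric_nondegenerate : forall f : {scalar 'rV[K]_(m + n)},
    exists! x, forall y, B x y = f y
}.

Definition abelian_lie m n : bracket K m n := fun _ _ => 0.

Definition lie_dsum m n m' n' (br : bracket K m n) (br' : bracket K m' n') :
    bracket K (m + m') (n + n') := fun x y =>
  let pr1 (u : 'rV[K]_((m + m') + (n + n'))) : 'rV[K]_(m + n) :=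
    row_mx (lsubmx (lsubmx u)) (lsubmx (rsubmx u)) in
  let pr2 (u : 'rV[K]_((m + m') + (n + n'))) : 'rV[K]_(m' + n') :=
    row_mx (rsubmx (lsubmx u)) (rsubmx (rsubmx u)) in
  let a := br (pr1 x) (pr1 y) in let b := br' (pr2 x) (pr2 y) in
  row_mx (row_mx (lsubmx a) (lsubmx b)) (row_mx (rsubmx a) (rsubmx b)).

(* Basis vectors are numbered from 1, even ones first. *)
Definition basis_vec N (k : nat) : 'rV[K]_N := \row_j (j.+1 == k)%:R.

(* [T i j] lists [e_i, e_j] for i <= j only (0 if not listed); the other
   brackets are determined by super skew-symmetry. *)
Definition bracket_of_table m n (T : nat -> nat -> 'rV[K]_(m + n)) :
    bracket K m n := fun x y =>
  let odd_index (i : nat) := (m < i)%N in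
  let basis_bracket (i j : nat) :=
    if (i <= j)%N then T i j
    else - ((-1) ^+ (odd_index i && odd_index j) *: T j i) in
  \sum_(i < m + n) \sum_(j < m + n)
    (x 0 i * y 0 j) *: basis_bracket i.+1 j.+1.

Definition g42_2 (lam : K) : bracket K 4 2 :=
  let e := @basis_vec (4 + 2) in
  bracket_of_table (m := 4) (n := 2) (fun i j =>
    match i, j with
    | 1, 2 => e 2
    | 1, 3 => (- e 3)%R
    | 2, 3 => e 4
    | 1, 5 => (lam *: e 5)%R
    | 1, 6 => (- (lam *: e 6))%R
    | 5, 6 => (lam *: e 4)%R
    | _, _ => 0%R
    end%N).

End LieSuper.

Definition g42_3 (K : fieldType) : bracket K 4 2 :=
  let e := @basis_vec K (4 + 2) in
  bracket_of_table (m := 4) (n := 2) (fun i j =>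
    match i, j with
    | 1, 2 => e 2
    | 1, 3 => (- e 3)%R
    | 2, 3 => e 4
    | 1, 5 => (2^-1 *: e 5)%R
    | 1, 6 => (- (2^-1 *: e 6))%R
    | 2, 6 => e 5
    | 5, 6 => (2^-1 *: e 4)%R
    | 6, 6 => e 3
    | _, _ => 0%R
    end%N).

Definition osp12 (K : fieldType) : bracket K 3 2 :=
  let e := @basis_vec K (3 + 2) in
  bracket_of_table (m := 3) (n := 2) (fun i j =>
    match i, j with
    | 1, 2 => e 3
    | 1, 3 => (- (2 *: e 1))%R
    | 2, 3 => (2 *: e 2)%R
    | 1, 5 => (- e 4)%R
    | 2, 4 => (- e 5)%R
    | 3, 4 => e 4
    | 3, 5 => (- e 5)%R
    | 4, 4 => (2^-1 *: e 1)%R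
    | 4, 5 => (4^-1 *: e 3)%R
    | 5, 5 => (- (2^-1 *: e 2))%R
    | _, _ => 0%R
    end%N).

Arguments abelian_lie K m n : clear implicits.
Arguments g42_3 K : clear implicits.
Arguments osp12 K : clear implicits.

(** * Formal deformations *)

(* g[[t]] is 'rV[fps K]_(m + n), and g sits in it through [row_const]. *)
Definition row_const (K : comNzRingType) N (x : 'rV[K]_N) : 'rV[fps K]_N :=
  map_mx (@fps_const K) x.

Section Deformation.
Variable K : comNzRingType.
Variables m n : nat.
Implicit Types (br : bracket K m n) (D : bracket (fps K) m n).

(* The map phi_i in D = \sum_i t^i phi_i; a K[[t]]-bilinear bracket is
   determined by these, and they inherit bilinearity, evenness and super
   skew-symmetry from it. *)
Definition deformation_term D (i : nat) : bracket K m n := fun x y =>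
  map_mx (fun f : fps K => f i) (D (row_const x) (row_const y)).

Definition is_deformation br D : Prop :=
  is_lie_super D /\ forall x y, deformation_term D 0 x y = br x y.

Definition deformation_equiv D D' : Prop :=
  exists psi : {linear 'rV[fps K]_(m + n) -> 'rV[fps K]_(m + n)},
    [/\ forall p x, homog p x -> homog p (psi x),
        forall x : 'rV[K]_(m + n),
          map_mx (fun f : fps K => f 0%N) (psi (row_const x)) = x
      & forall x y : 'rV[K]_(m + n),
          psi (D (row_const x) (row_const y)) =
          D' (psi (row_const x)) (psi (row_const y))].

(* The K[[t]]-bilinear extension of a bracket. *)
Definition const_deformation br : bracket (fps K) m n := fun x y =>
  \sum_(i < m + n) \sum_(j < m + n)
    (x 0 i * y 0 j) *: row_const (br (delta_mx 0 i) (delta_mx 0 j)).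

Definition trivial_deformation br D : Prop :=
  deformation_equiv D (const_deformation br).

Definition metric_deformation br D : Prop :=
  is_deformation br D /\ exists B, is_metric_form D B.

(* The deformation obtained from D by the substitution t := s(t). *)
Definition change_param (s : fps K) D : bracket (fps K) m n := fun x y =>
  \sum_(i < m + n) \sum_(j < m + n) (x 0 i * y 0 j) *:
    map_mx (fun f => fps_comp f s) (D (delta_mx 0 i) (delta_mx 0 j)).

(* D is, up to equivalence and change of parameter, the only nontrivial metric
   deformation of br. A change of parameter is a substitution t := s(t) with
   s(0) = 0 and s != 0; s need not be invertible under composition, as
   t := t^2 yields an inequivalent deformation. *)
Definition unique_metric_deformation br D : Prop :=
  [/\ metric_deformation br D,
      ~ trivial_deformation br D
    & forall D', metric_deformation br D' -> ~ trivial_deformation br D' ->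
        exists s : fps K,
          [/\ s 0%N = 0, s != 0 & deformation_equiv D' (change_param s D)]].

End Deformation.

(** * Specialization near the origin *)

Section Specialization.
Variable K : numFieldType.
Variables m n : nat.
Implicit Types (g : bracket K m n) (D : bracket (fps K) m n).

Definition fps_psum (f : fps K) (t : K) : nat -> K := series (fun i => f i * t ^+ i).

Definition deformation_cvg D (t : K) : Prop :=
  forall (x y : 'rV[K]_(m + n)) k,
    cvgn (fps_psum (D (row_const x) (row_const y) 0 k) t).

(* The bracket [x, y]_t for a value t of the parameter. *)
Definition deformation_at D (t : K) : bracket K m n := fun x y =>
  \row_k limn (fps_psum (D (row_const x) (row_const y) 0 k) t).

Definition jump_deformation m' n' g D (h : bracket K m' n') : Prop :=
  ~ lie_iso g h /\
  \forall t \near (0 : K)^', deformation_cvg D t /\ lie_iso (deformation_at D t) h.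

(* The algebras at distinct small non-zero values of t are pairwise
   non-isomorphic. This is the strict form of smoothness: it allows no
   coincidence, not even one caused by a symmetry of the parameter. *)
Definition smooth_deformation D : Prop :=
  exists2 A : set K, nbhs (0 : K)^' A &
    (forall t, A t -> deformation_cvg D t) /\
    (forall t u, A t -> A u -> t <> u ->
       ~ lie_iso (deformation_at D t) (deformation_at D u)).

Definition smooth_deformation_to m' n' D (h : K -> bracket K m' n') (lam0 : K) : Prop :=
  smooth_deformation D /\
  exists lam : K -> K,
    (lam t @[t --> (0 : K)^'] --> lam0) /\
    \forall t \near (0 : K)^', lie_iso (deformation_at D t) (h (lam t)).

End Specialization.

(* Main.v *)
Require Import Defs.
From HB Require Import structures.
From mathcomp Require Import all_boot all_order all_algebra.
From mathcomp Require Import all_classical all_reals all_analysis complex.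
From mathcomp Require Import ring.

Set Implicit Arguments.
Unset Strict Implicit.
Unset Printing Implicit Defensive.

Import GRing.Theory Num.Theory.
Import numFieldNormedType.Exports.
Local Open Scope ring_scope.

(** Over K[[t]] the operator ad e_1 of a metric deformation still has simple
    eigenvalues on each parity, so it can be diagonalized; invariance of the
    form makes the eigenvalues of e_2, e_3 (and of e_5, e_6) opposite.  When
    lambda <> 1/2, -1/2 all weights other than the original ones are
    non-resonant, so the Jacobi identity leaves only the parameter lambda, up
    to rescaling: the deformation is lambda |-> lambda + s(t).  For
    lambda = 1/2 the resonances [e_2, e_6] ~ e_5 and [e_3, e_5] ~ e_6 give a
    two-parameter family of brackets containing g_{4|2}^3 and osp(1,2) + C.
    The algebras are told apart by lambda^2 and by the vanishing of
    [[even, even], odd]. *)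

(** * Power series *)

(** The Jacobi identity alone would let e_4 acquire a nonzero weight m2 + m3 = n5 + n6 under ad e_1,
    which still acts by a derivation on the Heisenberg superalgebra spanned by the other vectors; so
    without a form there would be further deformations. The form enters the classification only to
    exclude this: nondegeneracy makes the pairings of e_2 with e_3 and of e_5 with e_6 invertible,
    and invariance then kills the sums of eigenvalues. The argument runs over K[[t]] at once instead
    of order by order: a series with nonzero constant term is invertible, so a nonvanishing
    condition on the undeformed weights eliminates a whole structure constant, where one would
    otherwise compute cohomology in each degree. All changes of basis are the identity modulo t, as
    an equivalence demands. *)

Section FpsTheory.
Variable K : comNzRingType.
Implicit Types f g h s : fps K.

Lemma fps_coefD f g n : (f + g) n = f n + g n. Proof. by []. Qed.
Lemma fps_coefN f n : (- f) n = - f n. Proof. by []. Qed.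
Lemma fps_coefB f g n : (f - g) n = f n - g n. Proof. by []. Qed.
Lemma fps_coefM f g n : (f * g) n = \sum_(i < n.+1) f i * g (n - i)%N.
Proof. by []. Qed.
Lemma fps_coefM0 f g : (f * g) 0%N = f 0%N * g 0%N.
Proof. by rewrite fps_coefM big_ord1. Qed.

(** Reduction modulo t, named so that it can carry the ring morphism structure used with [map_mx]
    and determinants. *)
Definition fps_head f : K := f 0%N.

Fact fps_head_is_zmod_morphism : zmod_morphism fps_head.
Proof. by []. Qed.
HB.instance Definition _ :=
  GRing.isZmodMorphism.Build (fps K) K fps_head fps_head_is_zmod_morphism.

Fact fps_head_is_monoid_morphism : monoid_morphism fps_head.
Proof. by split=> // f g; exact: fps_coefM0. Qed.
HB.instance Definition _ :=
  GRing.isMonoidMorphism.Build (fps K) K fps_head fps_head_is_monoid_morphism.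

Definition fps_of_poly (p : {poly K}) : fps K := Fps (fun n => p`_n).

Fact fps_of_poly_is_zmod_morphism : zmod_morphism fps_of_poly.
Proof. by move=> p q; apply: fpsP => n /=; rewrite coefB. Qed.
HB.instance Definition _ := GRing.isZmodMorphism.Build {poly K} (fps K)
  fps_of_poly fps_of_poly_is_zmod_morphism.

Fact fps_of_poly_is_monoid_morphism : monoid_morphism fps_of_poly.
Proof.
split=> [|p q]; apply: fpsP => n; last by rewrite /= coefM.
by rewrite /= coef1; case: n.
Qed.
HB.instance Definition _ := GRing.isMonoidMorphism.Build {poly K} (fps K)
  fps_of_poly fps_of_poly_is_monoid_morphism.

Lemma fps_of_polyC c : fps_of_poly c%:P = fps_const c.
Proof. by apply: fpsP => n; rewrite /= coefC; case: n. Qed.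

Fact fps_const_is_zmod_morphism : zmod_morphism (@fps_const K).
Proof. by move=> x y; rewrite -!fps_of_polyC polyCB raddfB. Qed.
HB.instance Definition _ := GRing.isZmodMorphism.Build K (fps K)
  (@fps_const K) fps_const_is_zmod_morphism.

Fact fps_const_is_monoid_morphism : monoid_morphism (@fps_const K).
Proof. by split=> // x y; rewrite -!fps_of_polyC polyCM rmorphM. Qed.
HB.instance Definition _ := GRing.isMonoidMorphism.Build K (fps K)
  (@fps_const K) fps_const_is_monoid_morphism.

Lemma fps_coef_constM c f n : (fps_const c * f) n = c * f n.
Proof.
rewrite fps_coefM big_ord_recl subn0 big1 ?addr0 // => i _.
by rewrite /= mul0r.
Qed.

Lemma fps_coef_comp f s n : fps_comp f s n = \sum_(k < n.+1) f k * (s ^+ k) n.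
Proof. by []. Qed.

Lemma fps_compD f g s : fps_comp (f + g) s = fps_comp f s + fps_comp g s.
Proof.
by apply: fpsP => n /=; rewrite -big_split; apply: eq_bigr => k _; rewrite mulrDl.
Qed.

Lemma fps_comp_constM c f s :
  fps_comp (fps_const c * f) s = fps_const c * fps_comp f s.
Proof.
apply: fpsP => n; rewrite fps_coef_constM !fps_coef_comp mulr_sumr.
by apply: eq_bigr => k _; rewrite fps_coef_constM mulrA.
Qed.

Lemma fps_comp_const c s : fps_comp (fps_const c) s = fps_const c.
Proof.
rewrite -[fps_const c]mulr1 fps_comp_constM; congr (_ * _).
apply: fpsP => n /=; rewrite big_ord_recl mul1r big1 ?addr0 // => i _.
by rewrite mul0r.
Qed.

Definition fps_X : fps K := fps_of_poly 'X.

Lemma fps_compX s : s 0%N = 0 -> fps_comp fps_X s = s.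
Proof.
move=> s0; apply: fpsP => -[|n] /=.
  by rewrite big_ord1 coefX mul0r s0.
rewrite big_ord_recl big_ord_recl coefX mul0r add0r coefX mul1r.
by rewrite big1 ?addr0 // => i _; rewrite coefX mul0r.
Qed.

Lemma head_row_const N (x : 'rV[K]_N) : map_mx fps_head (Defs.row_const x) = x.
Proof. by apply/rowP => k; rewrite !mxE. Qed.

End FpsTheory.

(** * Causal fixed points and congruence modulo powers of t *)

Section Contraction.

(** Iterating [F] from any start works: entry n depends only on earlier entries, so it no longer
    changes after n + 1 iterations. *)
Lemma causal_fixpoint (X : Type) (x0 : X) (F : (nat -> X) -> nat -> X) :
  (forall u v n, (forall k, (k < n)%N -> u k = v k) -> F u n = F v n) ->
  exists u, forall n, F u n = u n.
Proof.
move=> Fc; pose w m := iter m F (fun=> x0).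
have wS n : forall m, (n < m)%N -> w m n = w n.+1 n.
  elim/ltn_ind: n => n IHn [//|m] ltnm; rewrite /w !iterS.
  apply: Fc => k ltkn; rewrite -!/(w _) (IHn k ltkn n ltkn).
  by apply: IHn => //; apply: leq_trans ltkn _.
exists (fun n => w n.+1 n) => n; rewrite /w iterS; apply: Fc => k ltkn.
by rewrite -!/(w _) (wS k n ltkn).
Qed.

Variable K : comNzRingType.
Implicit Types f g h : fps K.

(** Congruence modulo t^n, the form in which causality is checked for power series. *)
Definition agree n f g := forall k, (k < n)%N -> f k = g k.

Lemma agreeD n f f' g g' : agree n f f' -> agree n g g' -> agree n (f + g) (f' + g').
Proof. by move=> Hf Hg k ltkn; rewrite !fps_coefD Hf ?Hg. Qed.

Lemma agreeN n f f' : agree n f f' -> agree n (- f) (- f').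
Proof. by move=> Hf k ltkn; rewrite !fps_coefN Hf. Qed.

Lemma agree_sum n (I : finType) (F G : I -> fps K) :
  (forall i, agree n (F i) (G i)) -> agree n (\sum_i F i) (\sum_i G i).
Proof.
by move=> FG; elim/big_ind2: _ => // f f' g g' Hf Hg; apply: agreeD.
Qed.

Lemma agreeM n f f' g g' : agree n f f' -> agree n g g' -> agree n (f * g) (f' * g').
Proof.
move=> Hf Hg k ltkn; rewrite !fps_coefM; apply: eq_bigr => i _.
rewrite Hf ?Hg //; first by rewrite (leq_ltn_trans (leq_subr _ _) ltkn).
by rewrite (leq_ltn_trans (leq_ord i) ltkn).
Qed.

(** A factor divisible by t gains one order; this is what makes the fixed-point equations below
    causal. *)
Lemma agree_contract n h f f' :
  h 0%N = 0 -> agree n f f' -> agree n.+1 (h * f) (h * f').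
Proof.
move=> h0 Hf k ltkn; rewrite !fps_coefM !big_ord_recl h0 !mul0r; congr +%R.
apply: eq_bigr => i _; rewrite Hf //.
case: k ltkn i => [|k] ltkn i; first by case: i.
by rewrite lift0 subSS (leq_ltn_trans (leq_subr _ _)).
Qed.

Lemma agree_constM n c f f' :
  agree n f f' -> agree n (fps_const c * f) (fps_const c * f').
Proof. by move=> Hf k ltkn; rewrite !fps_coef_constM Hf. Qed.

End Contraction.

Section FpsUnits.
Variable K : fieldType.
Implicit Types f g h : fps K.

Lemma fps_inv f : f 0%N != 0 -> exists g, f * g = 1.
Proof.
(* The equation u = 1 + h u says that c u is the inverse of f, and it is causal because h has no
   constant term. *)
move=> f0; pose c := (f 0%N)^-1; pose h := 1 - fps_const c * f.
have h0 : h 0%N = 0 by rewrite fps_coefB fps_coef_constM /= mulVf ?subrr.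
have [|u Hu] := @causal_fixpoint K 0 (fun u n => (1 + h * Fps u) n).
  by move=> u v n Huv; rewrite !fps_coefD (@agree_contract _ n h _ (Fps v)).
exists (fps_const c * Fps u); have {}Hu : 1 + h * Fps u = Fps u by apply: fpsP.
by have -> : 1 = Fps u - h * Fps u; [rewrite -{1}Hu addrK | rewrite /h; ring].
Qed.

Lemma fps_mul_eq0 f g : f 0%N != 0 -> f * g = 0 -> g = 0.
Proof.
move=> /fps_inv[f' f'K] /(congr1 ( *%R f')).
by rewrite mulr0 mulrA [f' * f]mulrC f'K mul1r.
Qed.

End FpsUnits.

(** * Coordinates on superspaces of dimension 4|2 *)

(** Numbering starts at 0 here but at 1 in [basis_vec]: coordinate k is the coefficient of e_(k+1),
    so the odd coordinates are 4 and 5. *)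
Notation "x `# k" := (x 0 (@inord 5 k)) (at level 2, k at level 1, format "x `# k").

Section Coordinates.
Variable K : comNzRingType.
Implicit Types x y : 'rV[K]_(4 + 2).

Definition vec6 (a b c d e f : K) : 'rV[K]_(4 + 2) :=
  \row_(j < 4 + 2) [:: a; b; c; d; e; f]`_j.

Lemma vec6E a b c d e f :
  ((vec6 a b c d e f)`#0 = a) * ((vec6 a b c d e f)`#1 = b) *
  ((vec6 a b c d e f)`#2 = c) * ((vec6 a b c d e f)`#3 = d) *
  ((vec6 a b c d e f)`#4 = e) * ((vec6 a b c d e f)`#5 = f).
Proof. by rewrite !mxE !inordK. Qed.

Lemma addE6 x y k : (x + y)`#k = x`#k + y`#k. Proof. by rewrite mxE. Qed.
Lemma oppE6 x k : (- x)`#k = - x`#k. Proof. by rewrite mxE. Qed.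
Lemma scaleE6 c x k : (c *: x)`#k = c * x`#k. Proof. by rewrite mxE. Qed.
Lemma zeroE6 k : (0 : 'rV[K]_(4 + 2))`#k = 0. Proof. by rewrite mxE. Qed.

Definition coordE := (addE6, oppE6, scaleE6, zeroE6, vec6E).

Lemma row6P x y :
  x`#0 = y`#0 -> x`#1 = y`#1 -> x`#2 = y`#2 -> x`#3 = y`#3 ->
  x`#4 = y`#4 -> x`#5 = y`#5 -> x = y.
Proof.
move=> H0 H1 H2 H3 H4 H5; apply/rowP => k; rewrite -[k](@inord_val 5).
by case: k => [[|[|[|[|[|[|]]]]]]].
Qed.

Lemma vec6_eta x : x = vec6 x`#0 x`#1 x`#2 x`#3 x`#4 x`#5.
Proof. by apply: row6P; rewrite vec6E. Qed.

Lemma sum6 (V : nmodType) (F : 'I_(4 + 2) -> V) :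
  \sum_i F i = F (@inord 5 0) + F (@inord 5 1) + F (@inord 5 2)
             + F (@inord 5 3) + F (@inord 5 4) + F (@inord 5 5).
Proof.
have E (i : 'I_(4 + 2)) k : val i = k -> i = @inord 5 k.
  by move=> <-; rewrite inord_val.
by rewrite !big_ord_recr big_ord0 /= add0r; do !congr (_ + _); congr F; apply: E.
Qed.

Lemma homog_evenP x : homog false x <-> x`#4 = 0 /\ x`#5 = 0.
Proof.
rewrite /homog /=; split=> [/rowP H|[H4 H5]].
  have := H 0; have := H 1; rewrite !mxE => H1 H0.
  by split; [rewrite -[RHS]H0 | rewrite -[RHS]H1]; congr (x 0 _);
     apply: val_inj; rewrite /= inordK.
apply/rowP => k; rewrite !mxE -[rshift _ _](@inord_val 5).
by case: k => [[|[|]]].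
Qed.

Lemma homog_oddP x :
  homog true x <-> [/\ x`#0 = 0, x`#1 = 0, x`#2 = 0 & x`#3 = 0].
Proof.
rewrite /homog /=; split=> [/rowP H|[H0 H1 H2 H3]].
  by split; [have := H 0|have := H 1|have := H 2%:R|have := H 3%:R];
    rewrite !mxE => E; rewrite -[RHS]E; congr (x 0 _);
    apply: val_inj; rewrite /= inordK.
apply/rowP => k; rewrite !mxE -[lshift _ _](@inord_val 5).
by case: k => [[|[|[|[|]]]]].
Qed.

Lemma vec6D a b c d e f a' b' c' d' e' f' :
  vec6 a b c d e f + vec6 a' b' c' d' e' f' =
  vec6 (a + a') (b + b') (c + c') (d + d') (e + e') (f + f').
Proof. by apply: row6P; rewrite addE6 !vec6E. Qed.

Lemma vec6N a b c d e f :
  - vec6 a b c d e f = vec6 (- a) (- b) (- c) (- d) (- e) (- f).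
Proof. by apply: row6P; rewrite oppE6 !vec6E. Qed.

Lemma vec6Z k a b c d e f :
  k *: vec6 a b c d e f = vec6 (k * a) (k * b) (k * c) (k * d) (k * e) (k * f).
Proof. by apply: row6P; rewrite scaleE6 !vec6E. Qed.

Lemma vec6_even a b c d : homog false (vec6 a b c d 0 0).
Proof. by apply/homog_evenP; rewrite !vec6E. Qed.

Lemma vec6_odd e f : homog true (vec6 0 0 0 0 e f).
Proof. by apply/homog_oddP; rewrite !vec6E. Qed.

Lemma homogE p x : homog p x ->
  x = if p then vec6 0 0 0 0 x`#4 x`#5 else vec6 x`#0 x`#1 x`#2 x`#3 0 0.
Proof.
case: p => [/homog_oddP[H0 H1 H2 H3]|/homog_evenP[H4 H5]]; rewrite {1}[x]vec6_eta.
  by rewrite H0 H1 H2 H3.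
by rewrite H4 H5.
Qed.

End Coordinates.

Lemma vec6_map (K L : comNzRingType) (h : {rmorphism K -> L}) a b c d e f :
  map_mx h (vec6 a b c d e f) = vec6 (h a) (h b) (h c) (h d) (h e) (h f).
Proof.
by apply/rowP => j; rewrite !mxE; case: j => [[|[|[|[|[|[|]]]]]]].
Qed.

Lemma homog_coord (K : comNzRingType) p (x : 'rV[K]_(4 + 2)) (k : 'I_(4 + 2)) :
  homog p x -> (3 < k)%N != p -> x 0 k = 0.
Proof.
move=> /homogE->; case: p; rewrite ?eqb_id ?eqbF_neg ?negbK;
  by case: k => [[|[|[|[|[|[|k]]]]]]] //= ? _; rewrite mxE.
Qed.

Lemma homog_mulmx (K : comNzRingType) p (x : 'rV[K]_(4 + 2)) (M : 'M[K]_(4 + 2)) :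
  (forall i : 'I_(4 + 2), homog (3 < i)%N (row i M)) -> homog p x -> homog p (x *m M).
Proof.
move=> HM hx; rewrite mulmx_sum_row /homog.
have Mi (i : 'I_(4 + 2)) : homog p (x 0 i *: row i M).
  have [<-|/(homog_coord hx) ->] := eqVneq (3 < i)%N p.
    by move: (HM i); rewrite /homog; case: (3 < i)%N => H; rewrite linearZ /= H scaler0.
  by rewrite scale0r /homog; case: p {hx}; rewrite linear0.
by case: p hx Mi => _ Mi; rewrite linear_sum big1 // => i _; apply: Mi.
Qed.

(** * A common family of brackets *)

Section Family.
Variable K : comNzRingType.
Variables w l a b a' b' : K.
Implicit Types x y z : 'rV[K]_(4 + 2).

(* With w = 1, the case a = b = a' = b' = 0 is the family g_{4|2}^2(l).  For
   l = 1/2 the weights of e_5, e_6 resonate with those of e_2, e_3, which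
   leaves room for the brackets [e_2, e_6] = a e_5 and [e_3, e_5] = b e_6; the
   other ones are forced by the Jacobi identity.  The parameters a', b' play
   the same role for l = -1/2. *)
Definition fam_coord (x0 x1 x2 x3 x4 x5 y0 y1 y2 y3 y4 y5 : K) :=
  vec6 0
    (w * (x0 * y1 - x1 * y0) + 2 * (a * b + a' * b') * (x3 * y1 - x1 * y3)
       - w * b * (x4 * y4) + w * b' * (x5 * y5))
    (- w * (x0 * y2 - x2 * y0) - 2 * (a * b + a' * b') * (x3 * y2 - x2 * y3)
       + w * a * (x5 * y5) - w * a' * (x4 * y4))
    ((x1 * y2 - x2 * y1) + l * (x4 * y5 + x5 * y4))
    (l * (x0 * y4 - x4 * y0) + a * (x1 * y5 - x5 * y1)
       + (a * b - a' * b') * (x3 * y4 - x4 * y3) + b' * (x2 * y5 - x5 * y2))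
    (- l * (x0 * y5 - x5 * y0) + a' * (x1 * y4 - x4 * y1)
       - (a * b - a' * b') * (x3 * y5 - x5 * y3) + b * (x2 * y4 - x4 * y2)).

Definition fam : bracket K 4 2 := fun x y =>
  fam_coord x`#0 x`#1 x`#2 x`#3 x`#4 x`#5 y`#0 y`#1 y`#2 y`#3 y`#4 y`#5.

Lemma famE (x0 x1 x2 x3 x4 x5 y0 y1 y2 y3 y4 y5 : K) :
  fam (vec6 x0 x1 x2 x3 x4 x5) (vec6 y0 y1 y2 y3 y4 y5) =
  fam_coord x0 x1 x2 x3 x4 x5 y0 y1 y2 y3 y4 y5.
Proof. by rewrite /fam !vec6E. Qed.

(** Resonance is written w = l + l rather than l = 1/2 with w = 1: after substitution the Jacobi
    identity and the invariance of the form are polynomial identities, which [ring] proves over any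
    commutative ring, in particular over K[[t]]. *)
Definition fam_lie_cond : Prop :=
  [\/ [/\ a = 0, b = 0, a' = 0 & b' = 0],
      [/\ w = l + l, a' = 0 & b' = 0]
    | [/\ w = - (l + l), a = 0 & b = 0]].

Lemma fam_linearr x : linear (fam x).
Proof.
move=> c y z; rewrite [x]vec6_eta [y]vec6_eta [z]vec6_eta.
by rewrite !(vec6Z, vec6D, famE); congr vec6; ring.
Qed.

Lemma fam_linearl y : linear (fam^~ y).
Proof.
move=> c x z; rewrite [x]vec6_eta [y]vec6_eta [z]vec6_eta.
by rewrite !(vec6Z, vec6D, famE); congr vec6; ring.
Qed.

Lemma fam_even p q x y : homog p x -> homog q y -> homog (p (+) q) (fam x y).
Proof.
move=> /homogE-> /homogE->; case: p; case: q => /=; rewrite famE.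
all: by [apply/homog_evenP; rewrite !vec6E; split; ring
        | apply/homog_oddP; rewrite !vec6E; split; ring].
Qed.

Lemma fam_skew p q x y : homog p x -> homog q y ->
  fam y x = - ((-1) ^+ (p && q) *: fam x y).
Proof.
move=> /homogE-> /homogE->; case: p; case: q => /=; rewrite ?expr0 ?expr1.
all: by rewrite !(famE, vec6Z, vec6N); congr vec6; ring.
Qed.

End Family.

Lemma fam_lie (K : comNzRingType) (w l a b a' b' : K) :
  fam_lie_cond w l a b a' b' -> is_lie_super (fam w l a b a' b').
Proof.
move=> cond; split; [exact: fam_linearr | exact: fam_linearl | exact: fam_even
  | exact: fam_skew | ].
move=> p q r x y z /homogE-> /homogE-> /homogE->.
case: cond => [[-> -> -> ->]|[-> -> ->]|[-> -> ->]]; case: p; case: q; case: r;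
  rewrite /= ?expr0 ?expr1.
all: rewrite !famE /fam_coord vec6Z vec6D; congr vec6; try ring.
Qed.

(** Normalised by B(e_2, e_3) = 1. Invariance then dictates B(e_1, e_4) = B([e_1, e_2], e_3) = w,
    and the (e_4, e_4) term is B(e_2, [e_3, e_4]). *)
Definition fam_form (K : comNzRingType) (w a b a' b' : K) (x y : 'rV[K]_(4 + 2)) : K :=
  w * (x`#0 * y`#3 + x`#3 * y`#0) + (x`#1 * y`#2 + x`#2 * y`#1)
  + 2 * (a * b + a' * b') * (x`#3 * y`#3) + w * (x`#4 * y`#5 - x`#5 * y`#4).

Lemma fam_form_invariant (K : comNzRingType) (w l a b a' b' : K) x y z :
  fam_lie_cond w l a b a' b' ->
  fam_form w a b a' b' (fam w l a b a' b' x y) z =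
  fam_form w a b a' b' x (fam w l a b a' b' y z).
Proof.
move=> cond; rewrite [x]vec6_eta [y]vec6_eta [z]vec6_eta !famE /fam_coord /fam_form.
by case: cond => [[-> -> -> ->]|[-> -> ->]|[-> -> ->]]; rewrite !vec6E; ring.
Qed.

Lemma scalarZ (K : comNzRingType) (V : lmodType K) (f : V -> K) c v :
  scalar f -> f (c *: v) = c * f v.
Proof.
move=> lin; pose h : {scalar _} := HB.pack f (GRing.isLinear.Build _ _ _ _ f lin).
by rewrite -[f]/(h : _ -> _) linearZ.
Qed.

Section Functionals.
Variable K : comNzRingType.

Definition unit6 (k : nat) : 'rV[K]_(4 + 2) :=
  vec6 (k == 0)%:R (k == 1)%:R (k == 2)%:R (k == 3)%:R (k == 4)%:R (k == 5)%:R.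

Lemma unit6_vec k : unit6 k =
  vec6 (k == 0)%:R (k == 1)%:R (k == 2)%:R (k == 3)%:R (k == 4)%:R (k == 5)%:R.
Proof. by []. Qed.

Lemma row6_sum (x : 'rV[K]_(4 + 2)) :
  x = x`#0 *: unit6 0 + x`#1 *: unit6 1 + x`#2 *: unit6 2 +
      x`#3 *: unit6 3 + x`#4 *: unit6 4 + x`#5 *: unit6 5.
Proof.
by rewrite {1}[x]vec6_eta !vec6Z !vec6D /=; congr vec6; ring.
Qed.

Lemma scalar6E (f : 'rV[K]_(4 + 2) -> K) (x : 'rV[K]_(4 + 2)) : scalar f ->
  f x = x`#0 * f (unit6 0) + x`#1 * f (unit6 1) + x`#2 * f (unit6 2) +
        x`#3 * f (unit6 3) + x`#4 * f (unit6 4) + x`#5 * f (unit6 5).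
Proof.
move=> lin; pose h : {scalar _} := HB.pack f (GRing.isLinear.Build _ _ _ _ f lin).
by rewrite -[f]/(h : _ -> _) {1}[x]row6_sum !linearD !linearZ.
Qed.

End Functionals.

Lemma fam_metric (K : comNzRingType) (l a b a' b' : K) :
  fam_lie_cond 1 l a b a' b' ->
  is_metric_form (fam 1 l a b a' b') (fam_form 1 a b a' b').
Proof.
move=> cond; split.
- by move=> x c y z; rewrite /fam_form !coordE; ring.
- by move=> x c y z; rewrite /fam_form !coordE; ring.
- move=> p q x y /homogE-> /homogE->; rewrite /fam_form.
  by case: p; case: q => //= _; rewrite !vec6E; ring.
- move=> p q x y /homogE-> /homogE->; rewrite /fam_form.
  by case: p; case: q => /=; rewrite ?expr0 ?expr1 !vec6E; ring.
- by move=> x y z; exact: fam_form_invariant.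
move=> f; have fE y := scalar6E y (linearP f).
pose u k := f (unit6 _ k); rewrite -!/(u _) in fE.
(* Here [u k] is the value of the functional on e_(k+1). The form pairs e_1 with e_4, e_2 with e_3
   and e_5 with e_6; its (e_4, e_4) entry only corrects the first coordinate. *)
exists (vec6 (u 3 - 2 * (a * b + a' * b') * u 0) (u 2) (u 1) (u 0) (u 5) (- u 4)).
split=> [y|x Hx]; first by rewrite fE /fam_form !vec6E; ring.
have Hu k : u k = fam_form 1 a b a' b' x (unit6 _ k) by rewrite Hx.
by rewrite [RHS]vec6_eta !Hu /fam_form /unit6 !vec6E /=; congr vec6; ring.
Qed.

(** The coefficients of [fam] are polynomials in its parameters. This one fact serves for reduction
    modulo t ([fps_head]), extension of constants ([fps_const]) and evaluation at a value of t
    ([horner_eval]). *)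
Lemma fam_map (K L : comNzRingType) (h : {rmorphism K -> L}) (w l a b a' b' : K) x y :
  map_mx h (fam w l a b a' b' x y) =
  fam (h w) (h l) (h a) (h b) (h a') (h b') (map_mx h x) (map_mx h y).
Proof.
by rewrite [x]vec6_eta [y]vec6_eta !famE /fam_coord !vec6_map famE /fam_coord;
  congr vec6; ring.
Qed.

Lemma basis_vecE (K : comNzRingType) k :
  basis_vec K (4 + 2) k =
  vec6 (1 == k)%:R (2 == k)%:R (3 == k)%:R (4 == k)%:R (5 == k)%:R (6 == k)%:R.
Proof. by apply: row6P; rewrite !mxE !inordK. Qed.

Lemma g42_2E (K : comNzRingType) (lam : K) : g42_2 lam = fam 1 lam 0 0 0 0.
Proof.
apply: funext => x; apply: funext => y.
rewrite [x]vec6_eta [y]vec6_eta famE /g42_2 /bracket_of_table !sum6 !vec6E !inordK //=.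
rewrite !basis_vecE /= !(vec6Z, vec6N, scaler0, addr0, add0r, oppr0, vec6D) /fam_coord.
by congr vec6; ring.
Qed.

Lemma g42_3E (K : fieldType) : g42_3 K = fam 1 2^-1 1 0 0 0.
Proof.
apply: funext => x; apply: funext => y.
rewrite [x]vec6_eta [y]vec6_eta famE /g42_3 /bracket_of_table !sum6 !vec6E !inordK //=.
rewrite !basis_vecE /= !(vec6Z, vec6N, scaler0, addr0, add0r, oppr0, vec6D) /fam_coord.
by congr vec6; ring.
Qed.

(** * Isomorphisms *)

Lemma lie_isoI (K : comNzRingType) (m n m' n' : nat)
    (br : bracket K m n) (br' : bracket K m' n')
    (f : 'rV[K]_(m + n) -> 'rV[K]_(m' + n')) g :
  linear f -> cancel f g -> cancel g f ->
  (forall p x, homog p x -> homog p (f x)) ->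
  (forall x y, f (br x y) = br' (f x) (f y)) -> lie_iso br br'.
Proof.
move=> lin fK gK hf hbr.
pose h : {linear _ -> _} := HB.pack f (GRing.isLinear.Build _ _ _ _ f lin).
by exists h; split=> //; exists g.
Qed.

(** Exchanging e_5 and e_6 reverses the odd weights; the extra sign on one of them also turns
    [e_5, e_6] = l e_4 into its analogue for -l. *)
Lemma fam_swap_iso (K : comNzRingType) (w l a b a' b' : K) :
  lie_iso (fam w l a b a' b') (fam w (- l) (- a') (- b') (- a) (- b)).
Proof.
pose f (x : 'rV[K]_(4 + 2)) := vec6 x`#0 x`#1 x`#2 x`#3 x`#5 (- x`#4).
pose g (x : 'rV[K]_(4 + 2)) := vec6 x`#0 x`#1 x`#2 x`#3 (- x`#5) x`#4.
apply: (@lie_isoI _ _ _ _ _ _ _ f g).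
- by move=> c x y; rewrite /f !coordE vec6Z vec6D; congr vec6; ring.
- by move=> x; rewrite /f /g !vec6E [RHS]vec6_eta opprK.
- by move=> x; rewrite /f /g !vec6E [RHS]vec6_eta opprK.
- move=> p x /homogE->; case: p; rewrite /f !vec6E; last first.
    by rewrite oppr0; exact: vec6_even.
  exact: vec6_odd.
- move=> x y; rewrite [x]vec6_eta [y]vec6_eta famE /fam_coord /f !vec6E famE.
  by rewrite /fam_coord; congr vec6; ring.
Qed.

Lemma fam_g42_3_iso (K : fieldType) (t : K) :
  t != 0 -> lie_iso (fam 1 2^-1 t 0 0 0) (g42_3 K).
Proof.
(* The rescaling e_2 -> t e_2, e_3 -> e_3 / t works for any weight h, so 1/2 is abstracted and
   [field] only needs t to be nonzero. *)
move=> t0; rewrite g42_3E; move: 2^-1 => h.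
pose f (x : 'rV[K]_(4 + 2)) := vec6 x`#0 (t * x`#1) (t^-1 * x`#2) x`#3 x`#4 x`#5.
pose g (x : 'rV[K]_(4 + 2)) := vec6 x`#0 (t^-1 * x`#1) (t * x`#2) x`#3 x`#4 x`#5.
apply: (@lie_isoI _ _ _ _ _ _ _ f g).
- by move=> c x y; rewrite /f !coordE vec6Z vec6D; congr vec6; ring.
- by move=> x; rewrite /f /g !vec6E [RHS]vec6_eta mulKf // mulVKf.
- by move=> x; rewrite /f /g !vec6E [RHS]vec6_eta mulKf // mulVKf.
- move=> p x /homogE->; case: p; rewrite /f !vec6E.
    by rewrite !mulr0; exact: vec6_odd.
  exact: vec6_even.
- move=> x y; rewrite [x]vec6_eta [y]vec6_eta famE /fam_coord /f !vec6E famE.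
  by rewrite /fam_coord; congr vec6; field.
Qed.

Section OspPlusLine.
Variable K : fieldType.

Lemma osp12E (x y : 'rV[K]_(3 + 2)) :
  let X k := x 0 (@inord 4 k) in let Y k := y 0 (@inord 4 k) in
  osp12 K x y = \row_(j < 3 + 2)
   [:: - 2 * (X 0 * Y 2 - X 2 * Y 0) + 2^-1 * (X 3 * Y 3);
       2 * (X 1 * Y 2 - X 2 * Y 1) - 2^-1 * (X 4 * Y 4);
       (X 0 * Y 1 - X 1 * Y 0) + 4^-1 * (X 3 * Y 4 + X 4 * Y 3);
       - (X 0 * Y 4 - X 4 * Y 0) + (X 2 * Y 3 - X 3 * Y 2);
       - (X 1 * Y 3 - X 3 * Y 1) - (X 2 * Y 4 - X 4 * Y 2)]`_j.
Proof.
move=> X Y; apply/rowP => j.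
have sum5 (V : nmodType) (F : 'I_(3 + 2) -> V) :
  \sum_i F i = F (@inord 4 0) + F (@inord 4 1) + F (@inord 4 2)
             + F (@inord 4 3) + F (@inord 4 4).
  have E (i : 'I_(3 + 2)) k : val i = k -> i = @inord 4 k.
    by move=> <-; rewrite inord_val.
  by rewrite !big_ord_recr big_ord0 /= add0r; do !congr (_ + _); congr F; apply: E.
rewrite /osp12 /bracket_of_table !sum5 !inordK //= !mxE -!/(X _) -!/(Y _).
by case: j => [[|[|[|[|[|]]]]]] //= _; ring.
Qed.

(* Same algebra with the basis (e_1, e_2, e_3, z | e_4, e_5). *)
Definition osp12_line : bracket K 4 2 := fun x y => vec6
  (- 2 * (x`#0 * y`#2 - x`#2 * y`#0) + 2^-1 * (x`#4 * y`#4))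
  (2 * (x`#1 * y`#2 - x`#2 * y`#1) - 2^-1 * (x`#5 * y`#5))
  ((x`#0 * y`#1 - x`#1 * y`#0) + 4^-1 * (x`#4 * y`#5 + x`#5 * y`#4))
  0
  (- (x`#0 * y`#5 - x`#5 * y`#0) + (x`#2 * y`#4 - x`#4 * y`#2))
  (- (x`#1 * y`#4 - x`#4 * y`#1) - (x`#2 * y`#5 - x`#5 * y`#2)).

Lemma osp12_lineE :
  lie_dsum (osp12 K) (abelian_lie K 1 0) = osp12_line :> bracket K 4 2.
Proof.
apply: funext => x; apply: funext => y.
(* The additional even vector sits at position 3, so the odd coordinates of osp(1,2) are shifted by
   one. *)
have prE (u : 'rV[K]_((3 + 1) + (2 + 0))) k : (k < 5)%N ->
    (row_mx (lsubmx (lsubmx u)) (lsubmx (rsubmx u)) : 'rV_(3 + 2)) 0 (@inord 4 k)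
      = u 0 (@inord 5 (if (k < 3)%N then k else k.+1)).
  move=> ltk5; rewrite mxE; case: splitP => j; rewrite !mxE inordK // => jE;
    congr (u 0 _); apply: val_inj; rewrite /= jE;
    by case: j {jE} => [[|[|[|]]]] //= lt_j; rewrite inordK.
apply/rowP => i; rewrite /lie_dsum !osp12E /= !prE //= /osp12_line !mxE.
case: splitP => j iE; rewrite !mxE; case: splitP => k jE; rewrite !mxE /= iE jE.
- by case: k jE => [[|[|[|]]]].
- by case: k jE => [[|]].
- by case: k jE => [[|[|]]].
- by case: k jE.
Qed.

Lemma fam_osp_iso (t : K) : 2 != 0 :> K -> t != 0 ->
  lie_iso (fam 1 2^-1 t t 0 0) (lie_dsum (osp12 K) (abelian_lie K 1 0)).
Proof.
move=> two0 t0.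
have four0 : 4 != 0 :> K by rewrite (natrM _ 2 2) mulf_neq0.
suff: lie_iso (fam 1 2^-1 t t 0 0) osp12_line by rewrite -osp12_lineE.
(* In the source e_1 - e_4 / (2 t^2) is central; [f] sends it to the generator of the abelian line,
   and e_2, e_3, e_4 to multiples of e_1, e_2, e_3 in osp(1,2). *)
pose f (x : 'rV[K]_(4 + 2)) := vec6 (- (2 * t) * x`#1) (- (t / 2) * x`#2)
  (x`#0 / 2 + t ^+ 2 * x`#3) x`#0 (2 * t * x`#4) (t * x`#5).
pose g (x : 'rV[K]_(4 + 2)) := vec6 x`#3 (- (x`#0 / (2 * t))) (- (2 * x`#1 / t))
  ((x`#2 - x`#3 / 2) / t ^+ 2) (x`#4 / (2 * t)) (x`#5 / t).
apply: (@lie_isoI _ _ _ _ _ _ _ f g).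
- by move=> c x y; rewrite /f !coordE vec6Z vec6D; congr vec6; field.
- by move=> x; rewrite /f /g !vec6E [RHS]vec6_eta; congr vec6; field; rewrite ?t0 ?two0.
- by move=> x; rewrite /f /g !vec6E [RHS]vec6_eta; congr vec6; field; rewrite ?t0 ?two0.
- move=> p x /homogE->; case: p; rewrite /f !vec6E.
    by rewrite !mulr0 mul0r addr0; exact: vec6_odd.
  by rewrite !mulr0; exact: vec6_even.
- move=> x y; rewrite [x]vec6_eta [y]vec6_eta famE /fam_coord /f !vec6E.
  rewrite /osp12_line !vec6E; congr vec6; field; rewrite ?t0 ?two0 ?four0 //.
Qed.

End OspPlusLine.

(** * Invariants *)

(** Split g x into its two parts; [f] preserves their parities, so the part of the wrong parity has
    image 0 and vanishes by injectivity. *)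
Lemma inverse_even (K : comNzRingType) (m n m' n' : nat)
    (f : {linear 'rV[K]_(m + n) -> 'rV[K]_(m' + n')}) g :
  cancel f g -> cancel g f -> (forall p x, homog p x -> homog p (f x)) ->
  forall p x, homog p x -> homog p (g x).
Proof.
move=> fK gK hf p x hx.
pose u0 : 'rV_(m + n) := row_mx (lsubmx (g x)) 0.
pose u1 : 'rV_(m + n) := row_mx 0 (rsubmx (g x)).
have gxE : g x = u0 + u1 by rewrite add_row_mx addr0 add0r hsubmxK.
have fxE : x = f u0 + f u1 by rewrite -linearD -gxE gK.
have h0 : homog false (f u0) by apply: hf; rewrite /homog row_mxKr.
have h1 : homog true (f u1) by apply: hf; rewrite /homog row_mxKl.
have homog0 (v : 'rV[K]_(m' + n')) : homog false v -> homog true v -> v = 0.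
  by rewrite /homog => v0 v1; rewrite -[v]hsubmxK v0 v1 row_mx0.
case: p hx => hx.
  have u00 : u0 = 0.
    apply: (can_inj fK); rewrite linear0; apply: homog0 => //.
    move: hx h1; rewrite [x]fxE /homog linearD /= => + h1.
    by rewrite h1 addr0.
  by rewrite gxE u00 add0r /homog row_mxKl.
have u10 : u1 = 0.
  apply: (can_inj fK); rewrite linear0; apply: homog0 => //.
  move: hx h0; rewrite [x]fxE /homog linearD /= => + h0.
  by rewrite h0 add0r.
by rewrite gxE u10 addr0 /homog row_mxKr.
Qed.

Lemma lie_iso_sym (K : comNzRingType) (m n m' n' : nat)
    (br : bracket K m n) (br' : bracket K m' n') :
  lie_iso br br' -> lie_iso br' br.
Proof.
case=> f [[g fK gK] hf hbr]; apply: (@lie_isoI _ _ _ _ _ _ _ g f) => //.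
- by move=> c x y; apply: (can_inj fK); rewrite linearP !gK.
- exact: inverse_even fK gK hf.
- by move=> x y; apply: (can_inj fK); rewrite hbr !gK.
Qed.

Lemma lie_iso_trans (K : comNzRingType) (m n m' n' m'' n'' : nat)
    (br : bracket K m n) (br' : bracket K m' n') (br'' : bracket K m'' n'') :
  lie_iso br br' -> lie_iso br' br'' -> lie_iso br br''.
Proof.
case=> f [[f' fK f'K] hf hbr] [g [[g' gK g'K] hg hbr']].
apply: (@lie_isoI _ _ _ _ _ _ _ (g \o f) (f' \o g')).
- by move=> c x y; rewrite /= !linearP.
- by move=> x; rewrite /= gK fK.
- by move=> x; rewrite /= f'K g'K.
- by move=> p x hx; apply/hg/hf.
- by move=> x y; rewrite /= hbr hbr'.
Qed.

Definition even_derived_kills_odd (K : comNzRingType) (m n : nat)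
    (br : bracket K m n) :=
  forall x y z, homog false x -> homog false y -> homog true z -> br (br x y) z = 0.

Lemma even_derived_iso (K : comNzRingType) (m n m' n' : nat)
    (br : bracket K m n) (br' : bracket K m' n') : lie_iso br br' ->
  even_derived_kills_odd br -> even_derived_kills_odd br'.
Proof.
move=> /lie_iso_sym[f [[g fK gK] hf hbr]] H x y z hx hy hz.
by apply: (can_inj fK); rewrite linear0 !hbr H //; apply: hf.
Qed.

Lemma even_derived_g42_2 (K : comNzRingType) (l : K) :
  even_derived_kills_odd (g42_2 l).
Proof.
move=> x y z /homogE-> /homogE-> /homogE->; rewrite g42_2E /= !famE /fam_coord.
by apply: row6P; rewrite !vec6E zeroE6; ring.
Qed.

Lemma g42_2_not_iso_g42_3 (K : fieldType) (l : K) : ~ lie_iso (g42_2 l) (g42_3 K).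
Proof.
move/even_derived_iso => /(_ (even_derived_g42_2 l)).
(* The invariant fails because [[e_1, e_2], e_6] = e_5 in the target. *)
move=> /(_ (vec6 1 0 0 0 0 0) (vec6 0 1 0 0 0 0) (vec6 0 0 0 0 0 1)).
move=> /(_ (vec6_even _ _ _ _) (vec6_even _ _ _ _) (vec6_odd _ _)).
rewrite g42_3E !famE /fam_coord => /(congr1 (fun v : 'rV_(4 + 2) => v`#4)).
rewrite !vec6E zeroE6 => /eqP; rewrite (_ : _ + _ = 1); last by ring.
by rewrite oner_eq0.
Qed.

Lemma g42_2_not_iso_osp (K : fieldType) (l : K) : 2 != 0 :> K ->
  ~ lie_iso (g42_2 l) (lie_dsum (osp12 K) (abelian_lie K 1 0)).
Proof.
move=> two0 iso.
have {iso} : lie_iso (g42_2 l) (@osp12_line K) by rewrite -osp12_lineE.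
move/even_derived_iso => /(_ (even_derived_g42_2 l)).
(* In osp(1,2) one has [[e_1, e_3], e_5] = 2 e_4. *)
move=> /(_ (vec6 1 0 0 0 0 0) (vec6 0 0 1 0 0 0) (vec6 0 0 0 0 0 1)).
move=> /(_ (vec6_even _ _ _ _) (vec6_even _ _ _ _) (vec6_odd _ _)).
move=> /(congr1 (fun v : 'rV_(4 + 2) => v`#4)).
rewrite /osp12_line !vec6E zeroE6 => /eqP; rewrite (_ : _ + _ = 2); last by ring.
by rewrite (negPf two0).
Qed.

(** Let x, y, z be the images of e_1, e_2, e_5, and x0 the e_1-coordinate of x. That y is an
    eigenvector of ad x for the eigenvalue 1 forces x0 = 1 or x0 = -1. On the odd part ad x has
    eigenvalues x0 l' and -x0 l', and z shows that l is one of them. *)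
Lemma g42_2_iso (K : fieldType) (l l' : K) :
  lie_iso (g42_2 l) (g42_2 l') -> l = l' \/ l = - l'.
Proof.
rewrite !g42_2E => -[f [[g fK gK] hf hbr]].
have f_neq0 (u : 'rV[K]_(4 + 2)) k : u`#k = 1 -> f u <> 0.
  move=> uk fu0; move: (oner_eq0 K); rewrite -uk.
  by rewrite (can_inj fK (etrans fu0 (esym (linear0 f)))) zeroE6 eqxx.
have := hf _ _ (vec6_even (1 : K) 0 0 0); have := hf _ _ (vec6_even (0 : K) 1 0 0).
have := hf _ _ (vec6_odd (1 : K) 0).
have := @f_neq0 (vec6 0 1 0 0 0 0) 1 (vec6E _ _ _ _ _ _).1.1.1.1.2.
have := @f_neq0 (vec6 0 0 0 0 1 0) 4 (vec6E _ _ _ _ _ _).1.2.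
have := hbr (vec6 1 0 0 0 0 0) (vec6 0 1 0 0 0 0).
have := hbr (vec6 1 0 0 0 0 0) (vec6 0 0 0 0 1 0).
rewrite !famE.
rewrite [X in f X](_ : _ = l *: vec6 0 0 0 0 1 0); last first.
  by rewrite /fam_coord vec6Z; congr vec6; ring.
rewrite linearZ [X in f X = fam _ _ _ _ _ _ _ _](_ : _ = vec6 0 1 0 0 0 0); last first.
  by rewrite /fam_coord; congr vec6; ring.
set x := f (vec6 1 0 0 0 0 0); set y := f (vec6 0 1 0 0 0 0).
set z := f (vec6 0 0 0 0 1 0).
move=> + + z0 y0 /homogE zE /homogE yE /homogE xE.
move: z0 y0; rewrite xE yE zE; move: (x`#0) (x`#1) (x`#2) (x`#3) => x0 x1 x2 x3.
move: (y`#0) (y`#1) (y`#2) (y`#3) (z`#4) (z`#5) => y0 y1 y2 y3 z4 z5 /=.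
move=> z_neq0 y_neq0; rewrite !famE /fam_coord vec6Z => Ez Ey.
have Ek k u v : u = v :> 'rV[K]_(4 + 2) -> u`#k = v`#k by move->.
have := (Ek 0 _ _ Ey, Ek 1 _ _ Ey, Ek 2 _ _ Ey, Ek 3 _ _ Ey).
have := (Ek 4 _ _ Ez, Ek 5 _ _ Ez); rewrite !vec6E => -[Ez4 Ez5] [[[Ey0 Ey1] Ey2] Ey3].
have {}Ez4 : (l - x0 * l') * z4 = 0.
  by apply/eqP; rewrite mulrBl subr_eq0 Ez4; apply/eqP; ring.
have {}Ez5 : (l + x0 * l') * z5 = 0.
  by apply/eqP; rewrite mulrDl addr_eq0 Ez5; apply/eqP; ring.
have {}Ey1 : (x0 - 1) * y1 = 0.
  by apply/eqP; rewrite mulrBl mul1r subr_eq0 [eqbRHS]Ey1 Ey0; apply/eqP; ring.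
have {}Ey2 : (x0 + 1) * y2 = 0.
  by apply/eqP; rewrite mulrDl mul1r addrC addr_eq0 [eqbLHS]Ey2 Ey0; apply/eqP; ring.
have [x01|x01] : x0 = 1 \/ x0 = - 1.
- move/eqP: Ey1; rewrite mulf_eq0 subr_eq0 => /orP[/eqP|/eqP y10]; first by left.
  move/eqP: Ey2; rewrite mulf_eq0 addr_eq0 => /orP[/eqP|/eqP y20]; first by right.
  case: y_neq0; apply: row6P; rewrite !vec6E zeroE6 //.
  by rewrite Ey3 y10 y20; ring.
- move: Ez4 Ez5; rewrite x01 !mul1r => /eqP + /eqP.
  rewrite !mulf_eq0 subr_eq0 addr_eq0 => /orP[/eqP|/eqP z40]; first by left.
  move=> /orP[/eqP|/eqP z50]; first by right.
  by case: z_neq0; rewrite z40 z50; apply: row6P; rewrite !vec6E zeroE6.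
- move: Ez4 Ez5; rewrite x01 !mulN1r opprK => /eqP + /eqP.
  rewrite !mulf_eq0 subr_eq0 addr_eq0 => /orP[/eqP|/eqP z40]; first by right.
  move=> /orP[/eqP|/eqP z50]; first by left.
  by case: z_neq0; rewrite z40 z50; apply: row6P; rewrite !vec6E zeroE6.
Qed.

(** * Deformations inside the family *)

(** The explicit deformations have polynomial coefficients, so their partial sums are eventually
    constant and specialization is evaluation. *)
Lemma horner_limn (K : numFieldType) (p : {poly K}) (t : K) :
  (fps_psum (fps_of_poly p) t @ \oo --> p.[t])%classic.
Proof.
apply: cvg_near_cst; exists (size p) => // n /= le_pn.
by rewrite /fps_psum /series /= (horner_coef_wide t le_pn) big_mkord.
Qed.

Section FamilyDeformation.
Variables (K : numFieldType) (w l a b a' b' : {poly K}).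

Let D := fam (fps_of_poly w) (fps_of_poly l) (fps_of_poly a) (fps_of_poly b)
             (fps_of_poly a') (fps_of_poly b').

Let D_const x y : D (Defs.row_const x) (Defs.row_const y) =
  map_mx (@fps_of_poly K)
    (fam w l a b a' b' (map_mx (@polyC K) x) (map_mx (@polyC K) y)).
Proof.
have constE (z : 'rV[K]_(4 + 2)) :
    Defs.row_const z = map_mx (@fps_of_poly K) (map_mx (@polyC K) z).
  by apply/rowP => k; rewrite !mxE fps_of_polyC.
by rewrite fam_map !constE.
Qed.

Let horner_const t (z : 'rV[K]_(4 + 2)) :
  map_mx (horner_eval t) (map_mx (@polyC K) z) = z.
Proof. by apply/rowP => k; rewrite !mxE /= /horner_eval hornerC. Qed.

Lemma fam_cvg t : deformation_cvg D t.
Proof.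
move=> x y k; rewrite D_const mxE; apply/cvg_ex; eexists; exact: horner_limn.
Qed.

Lemma fam_at t :
  deformation_at D t = fam w.[t] l.[t] a.[t] b.[t] a'.[t] b'.[t].
Proof.
apply: funext => x; apply: funext => y; apply/rowP => k; rewrite mxE D_const mxE.
rewrite (cvg_lim (@norm_hausdorff _ _) (@horner_limn _ _ _)).
rewrite -{2}(horner_const t x) -{2}(horner_const t y).
by rewrite -[RHS]/(fam (horner_eval t w) (horner_eval t l) (horner_eval t a)
  (horner_eval t b) (horner_eval t a') (horner_eval t b') _ _ 0 k) -fam_map [RHS]mxE.
Qed.

End FamilyDeformation.

Lemma fam_metric_deformation (K : comNzRingType) (l a b a' b' : fps K) :
  fam_lie_cond 1 l a b a' b' ->
  metric_deformation (fam 1 (l 0%N) (a 0%N) (b 0%N) (a' 0%N) (b' 0%N))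
    (fam 1 l a b a' b').
Proof.
move=> cond; split; last by exists (fam_form 1 a b a' b'); apply: fam_metric.
split; first exact: fam_lie.
move=> x y; rewrite /deformation_term -[map_mx _ _]/(map_mx (@fps_head K) _) fam_map.
by rewrite !head_row_const rmorph1.
Qed.

(** * Deformations free of t and changes of parameter *)

Section ConstChange.
Variable K : comNzRingType.

Lemma bilinear_delta (m n : nat) (br : bracket K m n) x y :
  (forall x, linear (br x)) -> (forall y, linear (br^~ y)) ->
  br x y = \sum_(i < m + n) \sum_(j < m + n)
    (x 0 i * y 0 j) *: br (delta_mx 0 i) (delta_mx 0 j).
Proof.
move=> linr linl.
pose br1 u : {linear _ -> _} :=
  HB.pack (br u) (GRing.isLinear.Build _ _ _ _ _ (linr u)).
pose br2 v : {linear _ -> _} :=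
  HB.pack (br^~ v) (GRing.isLinear.Build _ _ _ _ _ (linl v)).
rewrite {1}[x]row_sum_delta -[LHS]/(br2 y _) linear_sum; apply: eq_bigr => i _.
rewrite linearZ /= {1}[y]row_sum_delta -[br _ _]/(br1 _ _) linear_sum scaler_sumr.
by apply: eq_bigr => j _; rewrite linearZ /= scalerA.
Qed.

End ConstChange.

Lemma row_const_delta (K : comNzRingType) N (i : 'I_N) :
  Defs.row_const (delta_mx 0 i : 'rV[K]_N) = delta_mx 0 i.
Proof. by apply/rowP => k; rewrite !mxE; case: andP => _; rewrite ?rmorph0 ?rmorph1. Qed.

Lemma const_deformation_g42_2 (K : comNzRingType) (l : K) :
  const_deformation (g42_2 l) = g42_2 (fps_const l).
Proof.
apply: funext => x; apply: funext => y; rewrite !g42_2E.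
rewrite [RHS]bilinear_delta; [|exact: fam_linearr|exact: fam_linearl].
apply: eq_bigr => i _; apply: eq_bigr => j _; congr (_ *: _).
rewrite -[LHS]/(map_mx (@fps_const K) _) fam_map -!/(Defs.row_const _).
by rewrite !row_const_delta rmorph1 rmorph0.
Qed.

(** Since the bracket is affine in l, compatibility of [fps_comp] with sums and constant factors
    suffices to compute [change_param]. *)
Lemma fam_affine (K : comNzRingType) (l : K) x y :
  fam 1 l 0 0 0 0 x y =
  fam 1 0 0 0 0 0 x y + l *: (fam 1 1 0 0 0 0 x y - fam 1 0 0 0 0 0 x y).
Proof.
rewrite [x]vec6_eta [y]vec6_eta !famE /fam_coord vec6N vec6D vec6Z vec6D.
by congr vec6; ring.
Qed.

Lemma change_param_g42_2 (K : comNzRingType) (l : K) (s : fps K) : s 0%N = 0 ->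
  change_param s (g42_2 (fps_const l + fps_X K)) = g42_2 (fps_const l + s).
Proof.
move=> s0; apply: funext => x; apply: funext => y; rewrite !g42_2E.
rewrite [RHS]bilinear_delta; [|exact: fam_linearr|exact: fam_linearl].
apply: eq_bigr => i _; apply: eq_bigr => j _; congr (_ *: _).
have constE (c : K) : fam 1 (fps_const c) 0 0 0 0 (delta_mx 0 i) (delta_mx 0 j) =
    Defs.row_const (fam 1 c 0 0 0 0 (delta_mx 0 i) (delta_mx 0 j)).
  rewrite -[RHS]/(map_mx (@fps_const K) _) fam_map -!/(Defs.row_const _).
  by rewrite !row_const_delta rmorph1 rmorph0.
have fam0E := constE 0; have fam1E := constE 1; rewrite rmorph0 in fam0E.
rewrite rmorph1 in fam1E; rewrite !(fam_affine (_ + _)) fam0E fam1E.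
move: (fam (1 : K) 0 0 0 0 0 _ _) (fam (1 : K) 1 0 0 0 0 _ _) => u v.
apply/rowP => k; rewrite !mxE -rmorphB mulrDl fps_compD fps_compD.
rewrite [fps_X K * _]mulrC !fps_comp_constM fps_compX // !fps_comp_const.
ring.
Qed.

(** * Diagonalization over power series *)

(** Normalise v_i = 1. Coordinate i of v A = mu v then gives mu, and coordinate j becomes (d i - d
    j) v_j = sum_k E_kj v_k - (sum_k E_ki v_k) v_j, where E is A minus its constant term. As E is
    divisible by t and d i - d j is nonzero, this determines v coefficient by coefficient. *)
Lemma eigen_lift (K : fieldType) N (A : 'M[fps K]_N) (d : 'I_N -> K) (i : 'I_N) :
  (forall j k, A j k 0%N = d j *+ (j == k)) ->
  (forall j, j != i -> d j != d i) ->
  exists v : 'rV[fps K]_N, exists mu : fps K,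
    [/\ v *m A = mu *: v, forall j, v 0 j 0%N = (j == i)%:R & mu 0%N = d i].
Proof.
move=> A0 di; pose E j k := A j k - fps_const (d j *+ (j == k)).
have E0 j k : E j k 0%N = 0 by rewrite fps_coefB /= A0 subrr.
pose G (v : 'rV[fps K]_N) j := if j == i then 1 else fps_const (d i - d j)^-1 *
  (\sum_k E k j * v 0 k - \sum_k E k i * (v 0 k * v 0 j)).
(* The unknown is one vector over K for each power of t, so that all coordinates are solved
   simultaneously. *)
pose V (u : nat -> 'rV[K]_N) : 'rV[fps K]_N := \row_j Fps (fun n => u n 0 j).
have [|u Hu] := @causal_fixpoint _ (0 : 'rV[K]_N) (fun u n => \row_j G (V u) j n).
  move=> u v n uv; apply/rowP => j; rewrite !mxE /G.
  case: (eqVneq j i) => // ji.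
  have Vuv k : agree n (V u 0 k) (V v 0 k) by move=> p ltpn; rewrite !mxE /= uv.
  apply: (@agree_constM _ n.+1) => //.
  apply: agreeD; [|apply: agreeN]; apply: agree_sum => k; apply: agree_contract => //.
  exact: agreeM.
have VE j : V u 0 j = G (V u) j.
  apply: fpsP => n; rewrite [LHS](congr1 (fun f : fps K => f n) (mxE _ _ _ _)) /=.
  by rewrite -Hu mxE.
have Vi : V u 0 i = 1 by rewrite VE /G eqxx.
have AE k j : A k j = E k j + fps_const (d k *+ (k == j)) by rewrite subrK.
have diag_sum (v : 'rV[fps K]_N) j :
    \sum_k v 0 k * fps_const (d k *+ (k == j)) = fps_const (d j) * v 0 j.
  rewrite (bigD1 j) //= eqxx mulr1n mulrC big1 ?addr0 // => k /negPf ->.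
  by rewrite mulr0n rmorph0 mulr0.
have sum0 (F : 'I_N -> fps K) : (forall k, F k 0%N = 0) -> (\sum_k F k) 0%N = 0.
  move=> F0; rewrite -[LHS]/(fps_head _) raddf_sum big1 // => k _; exact: F0.
have mul0 (f g : fps K) : f 0%N = 0 -> (f * g) 0%N = 0.
  by move=> f0; rewrite fps_coefM0 f0 mul0r.
exists (V u), (fps_const (d i) + \sum_k E k i * V u 0 k); split.
- apply/rowP => j; rewrite [LHS]mxE [RHS]mxE.
  have -> : \sum_k V u 0 k * A k j =
      \sum_k E k j * V u 0 k + fps_const (d j) * V u 0 j.
    by rewrite -diag_sum -big_split; apply: eq_bigr => k _ /=; rewrite AE; ring.
  have [->|/[dup] ji /di] := eqVneq j i; first by rewrite Vi !mulr1 addrC.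
  rewrite eq_sym -subr_eq0 => dij.
  have := VE j; rewrite /G (negPf ji) => /(congr1 ( *%R (fps_const (d i - d j)))).
  rewrite mulrA -rmorphM mulfV // rmorph1 mul1r rmorphB mulrBl.
  have -> : \sum_k E k i * (V u 0 k * V u 0 j) = (\sum_k E k i * V u 0 k) * V u 0 j.
    by rewrite mulr_suml; apply: eq_bigr => k _; rewrite mulrA.
  move=> /eqP; rewrite subr_eq => /eqP Ej; rewrite mulrDl Ej.
  ring.
- move=> j; rewrite VE /G; case: eqP => // _; rewrite fps_coef_constM fps_coefB.
  by rewrite !sum0 ?subrr ?mulr0 // => k; apply: mul0.
- by rewrite fps_coefD sum0 ?addr0 // => k; apply: mul0.
Qed.

Lemma mx_inverse_fps (K : fieldType) N (A : 'M[fps K]_N) :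
  map_mx (@fps_head K) A = 1%:M ->
  exists2 B, A *m B = 1%:M & B *m A = 1%:M.
Proof.
move=> A1; have [|g gE] := @fps_inv K (\det A).
  by rewrite -[_ 0%N]/(fps_head _) -det_map_mx A1 det1 oner_eq0.
exists (g *: \adj A).
  by rewrite -scalemxAr mul_mx_adj scale_scalar_mx mulrC gE.
by rewrite -scalemxAl mul_adj_mx scale_scalar_mx mulrC gE.
Qed.

(** * Changes of basis *)

Section LieSuperTheory.
Variables (K : comNzRingType) (m n : nat) (br : bracket K m n).
Hypothesis br_lie : is_lie_super br.

Lemma lieDr x y z : br x (y + z) = br x y + br x z.
Proof. by have := lie_linearr br_lie x 1 y z; rewrite !scale1r. Qed.

Lemma lieDl x y z : br (x + y) z = br x z + br y z.
Proof. by have := lie_linearl br_lie z 1 x y; rewrite !scale1r. Qed.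

Lemma lie0r x : br x 0 = 0.
Proof. by apply: (addrI (br x 0)); rewrite -lieDr !addr0. Qed.

Lemma lie0l x : br 0 x = 0.
Proof. by apply: (addrI (br 0 x)); rewrite -lieDl !addr0. Qed.

Lemma lieZr c x y : br x (c *: y) = c *: br x y.
Proof. by have := lie_linearr br_lie x c y 0; rewrite lie0r !addr0. Qed.

Lemma lieZl c x y : br (c *: x) y = c *: br x y.
Proof. by have := lie_linearl br_lie y c x 0; rewrite lie0l !addr0. Qed.

End LieSuperTheory.

Section Transport.
Variables (K : comNzRingType) (m n : nat) (br : bracket K m n).
Variables (f g : {linear 'rV[K]_(m + n) -> 'rV[K]_(m + n)}).
Hypotheses (fK : cancel f g) (gK : cancel g f).
Hypothesis f_even : forall p x, homog p x -> homog p (f x).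

Definition transport : bracket K m n := fun x y => g (br (f x) (f y)).

Lemma transport_lie : is_lie_super br -> is_lie_super transport.
Proof.
move=> brL; have g_even := inverse_even fK gK f_even; split.
- by move=> x c y z; rewrite /transport linearP (lieDr brL) (lieZr brL) linearP.
- by move=> x c y z; rewrite /transport linearP (lieDl brL) (lieZl brL) linearP.
- by move=> p q x y hx hy; apply/g_even/(lie_even brL); apply: f_even.
- move=> p q x y hx hy; rewrite /transport -linearZ -linearN.
  by rewrite -(lie_skew brL) //; apply: f_even.
move=> p q r x y z hx hy hz; rewrite /transport !gK.
by rewrite (lie_jacobi brL (f_even hx) (f_even hy) (f_even hz)) linearD linearZ.
Qed.

Lemma transport_metric B :
  is_metric_form br B -> is_metric_form transport (fun x y => B (f x) (f y)).
Proof.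
move=> BM; split.
- by move=> x c y z; rewrite linearP (metric_linearr BM).
- by move=> x c y z; rewrite linearP (metric_linearl BM).
- by move=> p q x y hx hy; apply: (metric_even BM); apply: f_even.
- by move=> p q x y hx hy; apply: (metric_supersym BM); apply: f_even.
- by move=> x y z; rewrite !gK (metric_invariant BM).
move=> h; have [x [hx xU]] := metric_nondegenerate BM (h \o g).
exists (g x); split=> [y|x' hx']; first by rewrite gK hx /= fK.
by rewrite -[x']fK; congr (g _); apply: xU => y; rewrite -{1}[y]gK hx'.
Qed.

End Transport.

Section FpsChange.
Variables (K : fieldType) (m n : nat).
Local Notation head := (map_mx (@fps_head K)).

Lemma fps_linear_inverse N (f : {linear 'rV[fps K]_N -> 'rV[fps K]_N}) :
  (forall x, head (f x) = head x) ->
  exists g : {linear 'rV[fps K]_N -> 'rV[fps K]_N},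
    [/\ cancel f g, cancel g f & forall x, head (g x) = head x].
Proof.
move=> fh; have [|M M1 M2] := @mx_inverse_fps K N (lin1_mx f).
  apply/row_matrixP => i; rewrite -map_row rowE mul_rV_lin1 fh map_delta_mx.
  by rewrite rowE mulmx1.
have fE x : f x = x *m lin1_mx f by rewrite mul_rV_lin1.
exists (mulmxr M); split=> [x|x|x] /=.
- by rewrite fE -mulmxA M1 mulmx1.
- by rewrite fE -mulmxA M2 mulmx1.
- by rewrite -[in RHS](mulmx1 x) -M2 mulmxA -fE fh.
Qed.

(** The equivalence is the inverse of [f], which exists because [f] is the identity modulo t. A
    change of basis naturally arises in the direction of [f], from the normal form to [D]. *)
Lemma deformation_equivI (D D' : bracket (fps K) m n)
    (f : {linear 'rV[fps K]_(m + n) -> 'rV[fps K]_(m + n)}) :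
  (forall p x, homog p x -> homog p (f x)) ->
  (forall x, head (f x) = head x) ->
  (forall x y, f (D' x y) = D (f x) (f y)) -> deformation_equiv D D'.
Proof.
move=> f_even fh fD; have [g [fK gK gh]] := fps_linear_inverse fh.
exists g; split.
- exact: inverse_even fK gK f_even.
- by move=> x; rewrite -[LHS]/(head _) gh head_row_const.
- by move=> x y; rewrite -{1}[Defs.row_const x]gK -{1}[Defs.row_const y]gK -fD fK.
Qed.

(** [is_deformation] constrains the bracket on constant vectors; bilinearity extends the reduction
    modulo t to all of g[[t]]. *)
Lemma deformation_head (br : bracket K m n) (D : bracket (fps K) m n) x y :
  (forall u, linear (br u)) -> (forall v, linear (br^~ v)) ->
  is_deformation br D -> head (D x y) = br (head x) (head y).
Proof.
move=> linr linl [[Dlinr Dlinl _ _ _] D0].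
rewrite (bilinear_delta _ _ Dlinr Dlinl) [RHS](bilinear_delta _ _ linr linl).
rewrite raddf_sum; apply: eq_bigr => i _; rewrite raddf_sum; apply: eq_bigr => j _.
rewrite /= map_mxZ -D0 /deformation_term !row_const_delta; congr (_ *: _).
by rewrite rmorphM !mxE.
Qed.

End FpsChange.

Lemma unit6E (K : comNzRingType) k (j : 'I_(4 + 2)) :
  unit6 K k 0 j = (k == j)%:R.
Proof. by rewrite mxE; case: j => [[|[|[|[|[|[|]]]]]]]. Qed.

Lemma delta_unit6 (K : comNzRingType) (i : 'I_(4 + 2)) : delta_mx 0 i = unit6 K i.
Proof.
by apply/rowP => j; rewrite unit6E mxE eqxx eq_sym.
Qed.

Lemma unit6_homog (K : comNzRingType) k : homog (3 < k)%N (unit6 K k).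
Proof.
by case: k => [|[|[|[|[|[|k]]]]]]; first [exact: vec6_even | exact: vec6_odd].
Qed.

Lemma bracket_hom6 (K : comNzRingType) (br br' : bracket K 4 2)
    (f : {linear 'rV[K]_(4 + 2) -> 'rV[K]_(4 + 2)}) :
  is_lie_super br -> is_lie_super br' ->
  (forall p x, homog p x -> homog p (f x)) ->
  (forall i j, (i <= j < 6)%N ->
     f (br (unit6 K i) (unit6 K j)) = br' (f (unit6 K i)) (f (unit6 K j))) ->
  forall x y, f (br x y) = br' (f x) (f y).
Proof.
move=> brL brL' f_even H x y.
have H' (i j : 'I_(4 + 2)) : f (br (delta_mx 0 i) (delta_mx 0 j)) =
    br' (f (delta_mx 0 i)) (f (delta_mx 0 j)).
  rewrite !delta_unit6; have [leij|/ltnW leji] := leqP i j.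
    by apply: H; rewrite leij ltn_ord.
  rewrite (lie_skew brL (unit6_homog K j) (unit6_homog K i)).
  rewrite (lie_skew brL' (f_even _ _ (unit6_homog K j)) (f_even _ _ (unit6_homog K i))).
  by rewrite linearN linearZ /= H // leji ltn_ord.
rewrite (bilinear_delta _ _ (lie_linearr brL) (lie_linearl brL)).
rewrite [RHS](@bilinear_delta _ _ _ (fun u v => br' (f u) (f v))); first last.
- by move=> v c u w /=; rewrite linearP (lieDl brL') (lieZl brL').
- by move=> u c v w /=; rewrite linearP (lieDr brL') (lieZr brL').
rewrite linear_sum; apply: eq_bigr => i _; rewrite linear_sum; apply: eq_bigr => j _.
by rewrite linearZ /= H'.
Qed.

Section EigenLift.
Variables (K : fieldType) (T : {linear 'rV[fps K]_(4 + 2) -> 'rV[fps K]_(4 + 2)}).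
Variable d : nat -> K.
Hypothesis T_even : forall p x, homog p x -> homog p (T x).
Hypothesis T_head : forall x k, T x 0 k 0%N = d k * x 0 k 0%N.

(** The parities are lifted separately because an odd weight may equal an even one, for instance
    when lambda = 1; simplicity is required only within the even block. *)
Lemma eigen_lift_even i : (i < 4)%N ->
  (forall j, (j < 4)%N -> j != i -> d j != d i) ->
  exists v : 'rV[fps K]_(4 + 2), exists mu : fps K,
    [/\ T v = mu *: v, homog false v, map_mx (@fps_head K) v = unit6 K i
      & mu 0%N = d i].
Proof.
move=> lti4 di; pose e (v : 'rV[fps K]_4) : 'rV[fps K]_(4 + 2) := row_mx v 0.
have e_lin : linear e by move=> c u v; rewrite /e scale_row_mx add_row_mx scaler0 addr0.
pose el : {linear _ -> _} := HB.pack e (GRing.isLinear.Build _ _ _ _ e e_lin).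
pose A := lin1_mx (lsubmx \o T \o el).
have [j k||v [mu [vA v0 mu0]]] := @eigen_lift K 4 A (fun j => d j) (Ordinal lti4).
- rewrite !mxE /= T_head -[e _]/(row_mx _ _) row_mxEl !mxE eqxx /= eq_sym.
  by case: eqP => [->|_]; rewrite ?mulr1 ?mulr0.
- by move=> j; apply: di; rewrite ltn_ord.
have e_even : homog false (e v) by rewrite /homog row_mxKr.
exists (e v), mu; split=> //.
- rewrite -[LHS]hsubmxK (T_even e_even) -[lsubmx _]/((lsubmx \o T \o el) v).
  by rewrite -mul_rV_lin1 vA /e scale_row_mx scaler0.
- apply/rowP => k; rewrite unit6E [LHS]mxE /e mxE.
  case: splitP => j kE; last by rewrite mxE kE ltn_eqF // (leq_trans lti4) ?leq_addr.
  by rewrite -[LHS]/(_ 0%N) v0 -val_eqE eq_sym kE.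
Qed.

Lemma eigen_lift_odd i : (i < 2)%N ->
  (forall j, (j < 2)%N -> j != i -> d (4 + j) != d (4 + i)) ->
  exists v : 'rV[fps K]_(4 + 2), exists mu : fps K,
    [/\ T v = mu *: v, homog true v, map_mx (@fps_head K) v = unit6 K (4 + i)
      & mu 0%N = d (4 + i)%N].
Proof.
move=> lti2 di; pose e (v : 'rV[fps K]_2) : 'rV[fps K]_(4 + 2) := row_mx 0 v.
have e_lin : linear e by move=> c u v; rewrite /e scale_row_mx add_row_mx scaler0 addr0.
pose el : {linear _ -> _} := HB.pack e (GRing.isLinear.Build _ _ _ _ e e_lin).
pose A := lin1_mx (rsubmx \o T \o el).
have [j k||v [mu [vA v0 mu0]]] :=
    @eigen_lift K 2 A (fun j => d (4 + j)%N) (Ordinal lti2).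
- rewrite !mxE /= T_head -[e _]/(row_mx _ _) row_mxEr !mxE eqxx /= eq_sym.
  by case: eqP => [->|_]; rewrite ?mulr1 ?mulr0.
- by move=> j; apply: di; rewrite ltn_ord.
have e_odd : homog true (e v) by rewrite /homog row_mxKl.
exists (e v), mu; split=> //.
- rewrite -[LHS]hsubmxK (T_even e_odd) -[rsubmx _]/((rsubmx \o T \o el) v).
  by rewrite -mul_rV_lin1 vA /e scale_row_mx scaler0.
- apply/rowP => k; rewrite unit6E [LHS]mxE /e mxE.
  case: splitP => j kE; first last.
    by rewrite -[LHS]/(_ 0%N) v0 -val_eqE eq_sym kE eqn_add2l.
  by rewrite mxE kE gtn_eqF // (leq_trans (ltn_ord j)) ?leq_addr.
Qed.

End EigenLift.

(** * Brackets with diagonal ad e_1 *)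

Section DiagonalBracket.
Variables (K : numFieldType) (lam : K).
Hypotheses (lam0 : lam != 0) (lamp : lam != 2^-1) (lamn : lam != - 2^-1).

Local Notation R := (fps K).
Local Notation head := (map_mx (@fps_head K)).

(* An abstract copy of unit6: the conversion test would otherwise spend its
   time unfolding it to compare different basis vectors. *)
Variable u : nat -> 'rV[R]_(4 + 2).
Hypothesis uE : forall k, u k = unit6 R k.

Variables (br : bracket R 4 2) (B : 'rV[R]_(4 + 2) -> 'rV[R]_(4 + 2) -> R).
Hypotheses (brL : is_lie_super br) (BM : is_metric_form br B).
Hypothesis br_head : forall x y, head (br x y) = g42_2 lam (head x) (head y).

Variables m2 m3 n5 n6 : R.
Hypotheses (m2h : m2 0%N = 1) (n5h : n5 0%N = lam).
Hypotheses (br01 : br (u 0) (u 1) = m2 *: u 1) (br02 : br (u 0) (u 2) = m3 *: u 2)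
  (br04 : br (u 0) (u 4) = n5 *: u 4) (br05 : br (u 0) (u 5) = n6 *: u 5)
  (br12 : br (u 1) (u 2) = u 3).

Let two_neq0 : 2 != 0 :> K. Proof. by rewrite pnatr_eq0. Qed.

Let lam2p : 1 - (lam + lam) != 0.
Proof.
apply: contra lamp => /eqP E; apply/eqP; apply: (mulfI two_neq0).
by rewrite mulfV // -[RHS](subrK (lam + lam)) E; ring.
Qed.

Let lam2n : 1 + (lam + lam) != 0.
Proof.
apply: contra lamn => /eqP E; apply/eqP; apply: (mulfI two_neq0).
by rewrite mulrN mulfV // -[RHS]addr0 -E; ring.
Qed.

Let eq_opp0 (V : lmodType R) (v : V) : v = - v -> v = 0.
Proof.
have [|c cE] := @fps_inv K 2; first by rewrite fps_coefD /= -mulr2n.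
move=> vN; rewrite -[v]scale1r -cE mulrC -scalerA scaler_nat mulr2n {2}vN subrr.
exact: scaler0.
Qed.

Let u_homog k : homog (3 < k)%N (u k).
Proof. by rewrite uE; exact: unit6_homog. Qed.

Let ueven k : (k < 4)%N -> homog false (u k).
Proof. by rewrite ltnS => lek3; have := u_homog k; rewrite ltnNge lek3. Qed.

Let uodd k : (3 < k)%N -> homog true (u k).
Proof. by move=> lt3k; have := u_homog k; rewrite lt3k. Qed.

Let e0 := ueven (isT : 0 < 4)%N. Let e1 := ueven (isT : 1 < 4)%N.
Let e2 := ueven (isT : 2 < 4)%N. Let e3 := ueven (isT : 3 < 4)%N.
Let e4 := uodd (isT : 3 < 4)%N. Let e5 := uodd (isT : 3 < 5)%N.

Let br_even0 x : homog false x -> br x x = 0.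
Proof. by move=> hx; apply: eq_opp0; rewrite {1}(lie_skew brL hx hx) scale1r. Qed.

Let br_skew p x y : homog false x -> homog p y -> br y x = - br x y.
Proof. by move=> hx hy; rewrite (lie_skew brL hx hy) scale1r. Qed.

Let jac q r x y z : homog false x -> homog q y -> homog r z ->
  br x (br y z) = br (br x y) z + br y (br x z).
Proof. by move=> hx hy hz; rewrite (lie_jacobi brL hx hy hz) scale1r. Qed.

(** Invariance makes ad e_1 skew for [B]. *)
Let B_ad p x y c d : homog p x -> br (u 0) x = c *: x -> br (u 0) y = d *: y ->
  (c + d) * B x y = 0.
Proof.
move=> hx xE yE; have := metric_invariant BM x (u 0) y.
rewrite (br_skew e0 hx) xE yE -scaleNr.
rewrite (scalarZ _ _ (metric_linearl BM y)) (scalarZ _ _ (metric_linearr BM x)) => E.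
by rewrite mulrDl -E; ring.
Qed.

(** Nondegeneracy provides x such that B x y is coordinate i of y; expanding B x (u i) = 1 over the
    basis leaves the single term at j. *)
Let B_unit i j : (i < 6)%N -> (j < 6)%N ->
  (forall k, (k < 6)%N -> k != j -> B (u k) (u i) = 0) ->
  exists c, c * B (u j) (u i) = 1.
Proof.
move=> lti ltj B0; pose f (y : 'rV[R]_(4 + 2)) := y`#i.
have f_lin : scalar f by move=> c x y; rewrite /f !mxE.
pose h : {scalar _} := HB.pack f (GRing.isLinear.Build _ _ _ _ f f_lin).
have [x [xE _]] := metric_nondegenerate BM h.
exists (x`#j); have <- : B x (u i) = 1.
  by rewrite xE -[LHS]/((u i)`#i) uE unit6E inordK // eqxx.
pose Bi : {scalar _} :=
  HB.pack (B^~ (u i)) (GRing.isLinear.Build _ _ _ _ _ (metric_linearl BM (u i))).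
rewrite -[RHS]/(Bi x) {2}[x]row_sum_delta linear_sum.
rewrite (bigD1 (@inord 5 j)) //= big1 => [|k kj].
  by rewrite addr0 (scalarZ _ _ (metric_linearl BM (u i))) delta_unit6 -uE inordK.
rewrite (scalarZ _ _ (metric_linearl BM (u i))) delta_unit6 -uE B0 ?mulr0 ?ltn_ord //.
by apply: contra kj => /eqP <-; rewrite inord_val.
Qed.

Let m3E : m3 = - m2.
Proof.
have m2m2 : (m2 + m2) 0%N != 0 by rewrite fps_coefD m2h -mulr2n.
have [k ltk k2|c cE] := @B_unit 1 2 isT isT; last first.
  have := B_ad e2 br02 br01; move/(congr1 ( *%R c)).
  by rewrite mulrCA cE mulr0 mulr1 => /eqP; rewrite addr_eq0 => /eqP.
move: k ltk k2 => [|[|[|[|[|[|k]]]]]] // _ _.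
- have := B_ad e0 (etrans (br_even0 e0) (esym (scale0r _))) br01.
  by rewrite add0r => /fps_mul_eq0; apply; rewrite m2h oner_eq0.
- by have := B_ad e1 br01 br01 => /fps_mul_eq0; apply.
(* The weight m2 + m3 of [u 3] is not yet known, so invariance is applied directly: B(u 1,
   [u 1, u 2]) = B([u 1, u 1], u 2) = 0. *)
- rewrite (metric_supersym BM e1 e3) expr0 mul1r -br12.
  rewrite -(metric_invariant BM) (br_even0 e1).
  by rewrite -[0 in LHS](scale0r 0) (scalarZ _ _ (metric_linearl BM (u 2))) mul0r.
- exact: (metric_even BM e4 e1).
- exact: (metric_even BM e5 e1).
Qed.

Let n6E : n6 = - n5.
Proof.
have n5n5 : (n5 + n5) 0%N != 0.
  by rewrite fps_coefD n5h -mulr2n -mulr_natl mulf_neq0.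
have [k ltk k2|c cE] := @B_unit 4 5 isT isT; last first.
  have := B_ad e5 br05 br04; move/(congr1 ( *%R c)).
  by rewrite mulrCA cE mulr0 mulr1 => /eqP; rewrite addr_eq0 => /eqP.
move: k ltk k2 => [|[|[|[|[|[|k]]]]]] // _ _.
- exact: (metric_even BM e0 e4).
- exact: (metric_even BM e1 e4).
- exact: (metric_even BM e2 e4).
- exact: (metric_even BM e3 e4).
- by have := B_ad e4 br04 br04 => /fps_mul_eq0; apply.
Qed.

Let br03 : br (u 0) (u 3) = 0.
Proof.
by rewrite -br12 (jac e0 e1 e2) br01 br02 (lieZl brL) (lieZr brL) m3E scaleNr subrr.
Qed.

Let wt (k : nat) : R := [:: 0; m2; - m2; 0; n5; - n5]`_k.
Let wt_head (k : nat) : K := [:: 0; 1; -1; 0; lam; - lam]`_k.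

Let wtE k : wt k 0%N = wt_head k.
Proof.
by rewrite /wt /wt_head; case: k => [|[|[|[|[|[|k]]]]]];
  rewrite /= ?nth_nil ?fps_coefN ?m2h ?n5h.
Qed.

Let ad_unit k : (k < 6)%N -> br (u 0) (u k) = wt k *: u k.
Proof.
case: k => [|[|[|[|[|[|k]]]]]] ltk; rewrite /wt /=.
- exact: etrans (br_even0 e0) (esym (scale0r _)).
- exact: br01.
- exact: etrans br02 (congr1 ( *:%R^~ (u 2)) m3E).
- exact: etrans br03 (esym (scale0r _)).
- exact: br04.
- exact: etrans br05 (congr1 ( *:%R^~ (u 5)) n6E).
- by case: (notF ltk).
Qed.

Let ad_coord y k : br (u 0) y 0 k = wt k * y 0 k.
Proof.
pose L : {linear _ -> _} := HB.pack (br (u 0))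
  (GRing.isLinear.Build _ _ _ _ _ (lie_linearr brL (u 0))).
rewrite -[br _ _]/(L y) {1}[y]row_sum_delta linear_sum summxE (bigD1 k) //= big1.
  rewrite addr0 (lieZr brL) delta_unit6 -uE ad_unit // 2!mxE uE unit6E eqxx.
  by rewrite mulr1 mulrC.
move=> i ik; rewrite (lieZr brL) delta_unit6 -uE ad_unit ?ltn_ord //.
by rewrite 2!mxE uE unit6E val_eqE (negPf ik) !mulr0.
Qed.

(** The bracket is a weight vector, so [wt k - (wt i + wt j)] kills its coordinate k; the hypothesis
    makes the constant term of this factor nonzero, hence the factor a unit. *)
Let br_unit0 i j : (i < 6)%N -> (j < 6)%N ->
  (forall k, (k < 6)%N -> (3 < k)%N = (3 < i)%N (+) (3 < j)%N ->
     wt_head k - (wt_head i + wt_head j) != 0) ->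
  br (u i) (u j) = 0.
Proof.
move=> lti ltj H; set y := br _ _.
have yw : br (u 0) y = (wt i + wt j) *: y.
  rewrite (jac e0 (u_homog i) (u_homog j)) !ad_unit //.
  by rewrite (lieZl brL) (lieZr brL) scalerDl.
have yh : homog ((3 < i) (+) (3 < j))%N y.
  by apply: (lie_even brL); apply: u_homog.
apply/rowP => k; rewrite [RHS]mxE.
have [kp|/(homog_coord yh) //] := eqVneq (3 < k)%N ((3 < i) (+) (3 < j))%N.
apply: (@fps_mul_eq0 _ (wt k - (wt i + wt j))); last first.
  by rewrite mulrBl -ad_coord yw mxE subrr.
by rewrite fps_coefB fps_coefD !wtE; apply: H.
Qed.

Let nz_opp (c x : K) : c != 0 -> x = - c -> x != 0.
Proof. by move=> c0 ->; rewrite oppr_eq0. Qed.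

Let nz_eq (c x : K) : c != 0 -> x = c -> x != 0.
Proof. by move=> c0 ->. Qed.

Let lam2 : lam + lam != 0. Proof. by rewrite -mulr2n -mulr_natl mulf_neq0. Qed.

(** Up to sign, the constant terms of the weight differences are 1, 1 - 2 lam, 1 + 2 lam and 2 lam:
    here the exclusion of 1/2 and -1/2 enters. *)
Let br_unit_zero : [/\ br (u 1) (u 4) = 0, br (u 1) (u 5) = 0,
  br (u 2) (u 4) = 0 & br (u 2) (u 5) = 0] /\
  (br (u 4) (u 4) = 0 /\ br (u 5) (u 5) = 0).
Proof.
split; split; apply: br_unit0 => // -[|[|[|[|[|[|k]]]]]] // _ _; rewrite /wt_head /=.
all: first [apply: (nz_opp (oner_neq0 K)); ring | apply: (nz_eq (oner_neq0 K)); ring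
  | apply: (nz_opp lam2p); ring | apply: (nz_eq lam2p); ring
  | apply: (nz_opp lam2n); ring | apply: (nz_eq lam2n); ring
  | apply: (nz_opp lam2); ring | apply: (nz_eq lam2); ring].
Qed.

Let br34 : br (u 3) (u 4) = 0.
Proof.
have [[br14 _ br24 _] _] := br_unit_zero.
have := jac e1 e2 e4; rewrite br14 br24 !(lie0r brL) br12 addr0.
by move->.
Qed.

Let br35 : br (u 3) (u 5) = 0.
Proof.
have [[_ br15 _ br25] _] := br_unit_zero.
have := jac e1 e2 e5; rewrite br15 br25 !(lie0r brL) br12 addr0.
by move->.
Qed.

Let br45 : exists2 b : R, b 0%N = lam & br (u 4) (u 5) = b *: u 3.
Proof.
have [_ [br44 br55]] := br_unit_zero.
pose y := br (u 4) (u 5); have yh : homog false y by apply: (lie_even brL e4 e5).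
have y0 : br (u 0) y = 0.
  rewrite (jac e0 e4 e5) br04 br05 n6E (lieZl brL) (lieZr brL) scaleNr subrr //.
have y12 k : (0 < k < 3)%N -> y`#k = 0.
  move=> k12; apply: (@fps_mul_eq0 _ (wt k)).
    rewrite wtE; case: k k12 => [|[|[|k]]] // _;
      by rewrite /wt_head /= ?oppr_eq0 oner_eq0.
  by rewrite -[k in wt k](@inordK 5) -?ad_coord ?y0 ?mxE //;
    case: k k12 => [|[|[|k]]].
have yE : y = y`#0 *: u 0 + y`#3 *: u 3.
  rewrite {1}(homogE yh) (y12 1 isT) (y12 2 isT) !uE !unit6_vec !vec6Z vec6D /=.
  by congr vec6; ring.
(* As [u 4, u 4] = 0, the Jacobi identity gives [u 4, y] = - [u 4, y]. Since [u 4, u 0] = - n5 u 4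
   with n5 a unit, the component of y along [u 0] must vanish. *)
have br4y : br (u 4) y = 0.
  have := lie_jacobi brL e4 e4 e5; rewrite br44 (lie0l brL) add0r expr1 scaleN1r.
  exact: eq_opp0.
have y00 : y`#0 = 0.
  apply: (@fps_mul_eq0 _ n5); first by rewrite n5h.
  move: br4y; rewrite {1}yE (lieDr brL) !(lieZr brL) !(br_skew _ e4) // br04 br34.
  rewrite oppr0 scaler0 addr0 => /(congr1 (fun v : 'rV_(4 + 2) => v`#4)).
  rewrite scaleE6 oppE6 scaleE6 zeroE6 uE unit6_vec !vec6E /= mulr1 mulrN => /eqP.
  by rewrite oppr_eq0 mulrC => /eqP.
exists (y`#3); last by rewrite -/y [LHS]yE y00 scale0r; exact: add0r.
have := br_head (u 4) (u 5); rewrite -/y g42_2E.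
rewrite !uE !unit6_vec !(vec6_map (@fps_head K)) famE /fam_coord.
move=> /(congr1 (fun v : 'rV_(4 + 2) => v`#3)); rewrite mxE vec6E.
rewrite !rmorph_nat /= => E; rewrite -[LHS]/(fps_head _) E; ring.
Qed.

(** [u 3] is a unit multiple of [u 4, u 5], and both [u 1] and [u 2] kill [u 4] and [u 5]. *)
Let br13_23 : br (u 1) (u 3) = 0 /\ br (u 2) (u 3) = 0.
Proof.
have [[br14 br15 br24 br25] _] := br_unit_zero; have [b b0 bE] := br45.
have [|b' b'K] := @fps_inv K b; first by rewrite b0.
split.
- have := jac e1 e4 e5; rewrite br14 br15 (lie0l brL) (lie0r brL) addr0 bE (lieZr brL).
  move=> /(congr1 ( *:%R b')); rewrite scalerA [b' * b]mulrC b'K scale1r scaler0.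
  exact.
- have := jac e2 e4 e5; rewrite br24 br25 (lie0l brL) (lie0r brL) addr0 bE (lieZr brL).
  move=> /(congr1 ( *:%R b')); rewrite scalerA [b' * b]mulrC b'K scale1r scaler0.
  exact.
Qed.

Let vec6_0 : vec6 0 0 0 0 0 0 = 0 :> 'rV[R]_(4 + 2).
Proof. by apply: row6P; rewrite vec6E zeroE6. Qed.

Let g42_2_unit nu i j : (i <= j < 6)%N ->
  g42_2 nu (u i) (u j) = match i, j with
    | 0, 1 => u 1 | 0, 2 => (- u 2)%R | 0, 4 => (nu *: u 4)%R | 0, 5 => (- (nu *: u 5))%R
    | 1, 2 => u 3 | 4, 5 => (nu *: u 3)%R | _, _ => 0%R end%N.
Proof.
move: i j => [|[|[|[|[|[|i]]]]]] [|[|[|[|[|[|j]]]]]] //= _;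
  rewrite !uE !unit6_vec g42_2E famE /fam_coord ?vec6Z ?vec6N -?vec6_0 /=;
  congr vec6; ring.
Qed.

Lemma diagonal_bracket_iso :
  exists (f : {linear 'rV[R]_(4 + 2) -> 'rV[R]_(4 + 2)}) (nu : R),
  [/\ nu 0%N = lam, forall p x, homog p x -> homog p (f x),
      forall x, head (f x) = head x
    & forall x y, f (g42_2 nu x y) = br (f x) (f y)].
Proof.
have [[br14 br15 br24 br25] [br44 br55]] := br_unit_zero.
have [b b0 bE] := br45; have [br13 br23] := br13_23.
have [|b' b'K] := @fps_inv K b; first by rewrite b0.
have [|g gK] := @fps_inv K m2; first by rewrite m2h oner_eq0.
have g0 : g 0%N = 1.
  by have := congr1 (fun q : R => q 0%N) gK; rewrite fps_coefM0 m2h mul1r.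
(* Scaling e_1 by g = 1 / m2 gives e_2 the weight 1 and e_5 the weight nu; scaling e_5 by c = nu / b
   then gives [e_5, e_6] = nu e_4. Both factors have constant term 1. *)
pose nu := g * n5; pose c := nu * b'.
have nu0 : nu 0%N = lam by rewrite fps_coefM0 g0 n5h mul1r.
have cb : c * b = nu by rewrite /c -mulrA [b' * b]mulrC b'K mulr1.
have c0 : c 0%N = 1.
  apply: (mulIf lam0); rewrite mul1r -[RHS]nu0 -cb fps_coefM0 b0.
  reflexivity.
pose f (x : 'rV[R]_(4 + 2)) := vec6 (g * x`#0) x`#1 x`#2 x`#3 (c * x`#4) x`#5.
have f_lin : linear f.
  by move=> k x y; rewrite /f !coordE vec6Z vec6D; congr vec6; ring.
pose h : {linear _ -> _} := HB.pack f (GRing.isLinear.Build _ _ _ _ f f_lin).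
have h_even p x : homog p x -> homog p (h x).
  move=> /homogE->; rewrite /= /f; case: p; rewrite !vec6E !mulr0.
    exact: vec6_odd.
  exact: vec6_even.
exists h, nu; split=> //.
  move=> x; rewrite -[h x]/(f x) (vec6_map (@fps_head K)) [RHS]vec6_eta.
  congr vec6; rewrite mxE /fps_head // -[LHS]/((_ * _ : R) 0%N) fps_coefM0.
    by rewrite g0 mul1r.
  by rewrite c0 mul1r.
have hu k : (k < 6)%N -> k != 0 -> k != 4 -> h (u k) = u k.
  move: k => [|[|[|[|[|[|k]]]]]] //= _ _ _; rewrite uE unit6_vec /f !vec6E /= !mulr0;
  reflexivity.
have hu0 : h (u 0) = g *: u 0.
  by rewrite /= uE unit6_vec /f !vec6E vec6Z /= !mulr0.
have hu4 : h (u 4) = c *: u 4.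
  by rewrite /= uE unit6_vec /f !vec6E vec6Z /= !mulr0.
have [hu1 hu2 hu3 hu5] : [/\ h (u 1) = u 1, h (u 2) = u 2, h (u 3) = u 3 & h (u 5) = u 5].
  by split; apply: hu.
apply: (@bracket_hom6 _ (g42_2 nu) br h _ brL h_even) => [|i j ij].
  by rewrite g42_2E; apply: fam_lie; constructor 1.
rewrite -!uE g42_2_unit //.
have z1 : h 0 = 0 by exact: linear0.
have hZ k v : h (k *: v) = k *: h v by exact: linearZ.
have hN v : h (- v) = - h v by exact: linearN.
move: i j ij => [|[|[|[|[|[|i]]]]]] [|[|[|[|[|[|j]]]]]] ij;
  try by case/andP: ij => h1 h2; first [case: (notF h1) | case: (notF h2)].
all: rewrite ?hu0 ?hu1 ?hu2 ?hu3 ?hu4 ?hu5 ?(lieZl brL) ?(lieZr brL).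
- by rewrite z1 (br_even0 e0) !scaler0.
- by rewrite br01 scalerA [g * m2]mulrC gK scale1r.
- by rewrite hN hu2 br02 m3E scalerA mulrN [g * m2]mulrC gK scaleN1r.
- by rewrite z1 br03 scaler0.
- by rewrite hZ hu4 br04 !scalerA; congr (_ *: _); rewrite /nu; ring.
- rewrite hN hZ hu5 br05 n6E scalerA -scaleNr; congr (_ *: _).
  by rewrite /nu; ring.
- by rewrite z1 (br_even0 e1).
- by rewrite br12.
- by rewrite z1 br13.
- by rewrite z1 br14 scaler0.
- by rewrite z1 br15.
- by rewrite z1 (br_even0 e2).
- by rewrite z1 br23.
- by rewrite z1 br24 scaler0.
- by rewrite z1 br25.
- by rewrite z1 (br_even0 e3).
- by rewrite z1 br34 scaler0.
- by rewrite z1 br35.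
- by rewrite z1 br44 !scaler0.
- rewrite hZ hu3 bE scalerA cb; reflexivity.
- by rewrite z1 br55.
Qed.

End DiagonalBracket.

(** * Classification of the metric deformations *)

Lemma metric_deformation_g42_2 (K : numFieldType) (lam : K)
    (D : bracket (fps K) 4 2) :
  lam != 0 -> lam != 2^-1 -> lam != - 2^-1 -> metric_deformation (g42_2 lam) D ->
  exists2 nu : fps K, nu 0%N = lam & deformation_equiv D (g42_2 nu).
Proof.
move=> lam0 lamp lamn [D_def [B BM]]; have [DL _] := D_def.
have Dh x y : map_mx (@fps_head K) (D x y) =
    g42_2 lam (map_mx (@fps_head K) x) (map_mx (@fps_head K) y).
  by apply: deformation_head D_def; rewrite g42_2E => z;
    [exact: fam_linearr | exact: fam_linearl].
have [u uE] : exists u, forall k, u k = unit6 (fps K) k by exists (unit6 (fps K)).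
have u_head k : map_mx (@fps_head K) (u k) = unit6 K k.
  by rewrite uE !unit6_vec (vec6_map (@fps_head K)) !rmorph_nat.
have e0 : homog false (u 0) by rewrite uE; exact: vec6_even.
pose T : {linear _ -> _} := HB.pack (D (u 0))
  (GRing.isLinear.Build _ _ _ _ _ (lie_linearr DL (u 0))).
pose d (k : nat) : K := [:: 0; 1; -1; 0; lam; - lam]`_k.
have T_even p x : homog p x -> homog p (T x) by move=> hx; exact: (lie_even DL e0 hx).
have T_head x k : T x 0 k 0%N = d k * x 0 k 0%N.
  have : map_mx (@fps_head K) (T x) 0 k = d k * (map_mx (@fps_head K) x) 0 k.
    rewrite Dh u_head unit6_vec; move: (map_mx _ x) => y.
    rewrite [y]vec6_eta g42_2E famE /fam_coord !mxE /d.
    by case: k => [[|[|[|[|[|[|k]]]]]]] //= _; ring.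
  by rewrite !mxE.
have n01 : 0 != 1 :> K by rewrite eq_sym oner_eq0.
have n0m : 0 != -1 :> K by rewrite eq_sym oppr_eq0 oner_eq0.
have n1m : 1 != -1 :> K by rewrite -subr_eq0 opprK -mulr2n pnatr_eq0.
have nm1 : -1 != 1 :> K by rewrite eq_sym.
have [|v1 [m2 [v1E h1 v1h m2h]]] := @eigen_lift_even K T d T_even T_head 1 isT.
  move=> [|[|[|[|k]]]] ltk; [move=> _; exact: n01 | by [] | | | case: (notF ltk)];
    [move=> _; exact: nm1 | move=> _; exact: n01].
have [|v2 [m3 [v2E h2 v2h m3h]]] := @eigen_lift_even K T d T_even T_head 2 isT.
  move=> [|[|[|[|k]]]] ltk; [move=> _; exact: n0m | | by [] | | case: (notF ltk)];
    [move=> _; exact: n1m | move=> _; exact: n0m].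
have lam_opp : lam != - lam.
  by rewrite -subr_eq0 opprK -mulr2n -mulr_natl mulf_neq0 // pnatr_eq0.
have [|v4 [n5 [v4E h4 v4h n5h]]] := @eigen_lift_odd K T d T_even T_head 0 isT.
  by move=> [|[|k]] ltk; [| move=> _; rewrite eq_sym; exact: lam_opp | case: (notF ltk)].
have [|v5 [n6 [v5E h5 v5h n6h]]] := @eigen_lift_odd K T d T_even T_head 1 isT.
  by move=> [|[|k]] ltk; [move=> _; exact: lam_opp | | case: (notF ltk)].
(* The eigenvalue 0 of ad e_1 is double modulo t, so the fourth vector is not lifted as an
   eigenvector; e_1 is kept and e_4 becomes a bracket. *)
pose v3 := D v1 v2; have h3 : homog false v3 by exact: (lie_even DL h1 h2).
have v3h : map_mx (@fps_head K) v3 = unit6 K 3.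
  rewrite Dh v1h v2h !unit6_vec g42_2E famE /fam_coord.
  by congr vec6; rewrite /=; ring.
pose V (k : nat) := [:: u 0; v1; v2; v3; v4; v5]`_k.
pose M : 'M[fps K]_(4 + 2) := \matrix_(i < 4 + 2) V i.
pose F : {linear 'rV[fps K]_(4 + 2) -> 'rV[fps K]_(4 + 2)} := mulmxr M.
have F_even p x : homog p x -> homog p (F x).
  apply: homog_mulmx => i; rewrite rowK /V.
  case: i => [[|[|[|[|[|[|i]]]]]] lti]; [exact: e0 | exact: h1 | exact: h2
    | exact: h3 | exact: h4 | exact: h5 | case: (notF lti)].
have V_head k : (k < 6)%N -> map_mx (@fps_head K) (V k) = unit6 K k.
  case: k => [|[|[|[|[|[|k]]]]]] ltk; [exact: u_head | exact: v1h | exact: v2h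
    | exact: v3h | exact: v4h | exact: v5h | case: (notF ltk)].
have F_head x : map_mx (@fps_head K) (F x) = map_mx (@fps_head K) x.
  have M1 : map_mx (@fps_head K) M = 1%:M.
    apply/row_matrixP => i; rewrite -map_row rowK row1 delta_unit6.
    by apply: V_head; exact: ltn_ord.
  by rewrite /= map_mxM M1 mulmx1.
have F_u k : (k < 6)%N -> F (u k) = V k.
  move=> ltk; rewrite uE -[k in unit6 _ k](@inordK 5) // -delta_unit6 /= -rowE rowK.
  by rewrite inordK.
have [G [FK GK G_head]] := fps_linear_inverse F_head.
pose br := transport D F G.
have brL : is_lie_super br by exact: transport_lie FK GK F_even DL.
have brM := transport_metric FK GK F_even BM.
have br_head x y : map_mx (@fps_head K) (br x y) =
    g42_2 lam (map_mx (@fps_head K) x) (map_mx (@fps_head K) y).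
  by rewrite /br /transport G_head Dh !F_head.
have br_ad k mu : (k < 6)%N -> T (V k) = mu *: V k -> br (u 0) (u k) = mu *: u k.
  move=> ltk VE; rewrite /br /transport (F_u 0 isT) (F_u k ltk) [D _ _]VE linearZ.
  by rewrite -(F_u k ltk) FK.
have br12 : br (u 1) (u 2) = u 3.
  by rewrite /br /transport (F_u 1 isT) (F_u 2 isT) -[D _ _]/(V 3) -(F_u 3 isT) FK.
have [h [nu [nu0 h_even h_head hE]]] :=
  diagonal_bracket_iso lam0 lamp lamn uE brL brM br_head m2h n5h
    (br_ad 1 m2 isT v1E) (br_ad 2 m3 isT v2E) (br_ad 4 n5 isT v4E)
    (br_ad 5 n6 isT v5E) br12.
exists nu => //; apply: (@deformation_equivI _ _ _ D (g42_2 nu) (F \o h)).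
- by move=> p x hx; apply/F_even/h_even.
- by move=> x; exact: etrans (F_head _) (h_head x).
- move=> x y; change (F (h (g42_2 nu x y)) = D (F (h x)) (F (h y))).
  by rewrite hE /br /transport GK.
Qed.

(** * The deformation lambda + t *)

Section Shift.
Variables (K : numFieldType) (lam : K).

Definition shift_deformation : bracket (fps K) 4 2 := g42_2 (fps_const lam + fps_X K).

Let shiftE : shift_deformation = fam (fps_of_poly 1) (fps_of_poly (lam%:P + 'X))
  (fps_of_poly 0) (fps_of_poly 0) (fps_of_poly 0) (fps_of_poly 0).
Proof.
by rewrite /shift_deformation g42_2E rmorph1 rmorph0 raddfD /= fps_of_polyC.
Qed.

Lemma shift_metric : metric_deformation (g42_2 lam) shift_deformation.
Proof.
rewrite /shift_deformation !g42_2E -[X in fam 1 X](_ : (fps_const lam + fps_X K) 0%N = _).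
  by apply: fam_metric_deformation; constructor 1.
by rewrite fps_coefD /= coefX addr0.
Qed.

Lemma shift_at t : deformation_at shift_deformation t = g42_2 (lam + t).
Proof. by rewrite shiftE fam_at g42_2E !hornerE. Qed.

(** An equivalence is the identity modulo t, so coordinate 1 of the image of e_2 and coordinate 4 of
    the image of e_5 are units. The relation [e_1, e_2] = e_2 then forces the e_1-coordinate of the
    image of e_1 to be 1, and [e_1, e_5] yields lam + t = lam. *)
Lemma shift_nontrivial : ~ trivial_deformation (g42_2 lam) shift_deformation.
Proof.
rewrite /trivial_deformation const_deformation_g42_2 => -[f [f_even f_head f_hom]].
have [u uE] : exists u, forall k, u k = unit6 (fps K) k by exists (unit6 (fps K)).
have uc k : Defs.row_const (unit6 K k) = u k.
  by rewrite uE !unit6_vec [LHS](vec6_map (@fps_const K)) !rmorph_nat.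
have f_coord k : (f (u k))`#k 0%N = (unit6 K k)`#k.
  by rewrite -uc -{2}(f_head (unit6 K k)) mxE.
have hom k l : f (shift_deformation (u k) (u l)) =
    g42_2 (fps_const lam) (f (u k)) (f (u l)).
  by rewrite -!uc f_hom.
have u_homog k : homog (3 < k)%N (u k) by rewrite uE; exact: unit6_homog.
have hx : homog false (f (u 0)) by apply: f_even; apply: (u_homog 0).
have hy : homog false (f (u 1)) by apply: f_even; apply: (u_homog 1).
have hz : homog true (f (u 4)) by apply: f_even; apply: (u_homog 4).
have E01 : shift_deformation (u 0) (u 1) = u 1.
  rewrite !uE !unit6_vec /shift_deformation g42_2E famE /fam_coord /=.
  by congr vec6; ring.
have E04 : shift_deformation (u 0) (u 4) = (fps_const lam + fps_X K) *: u 4.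
  rewrite !uE !unit6_vec /shift_deformation g42_2E famE /fam_coord vec6Z /=.
  by congr vec6; ring.
have := hom 0 4; have := hom 0 1; rewrite E01 E04 linearZ g42_2E.
have := f_coord 4; have := f_coord 1; rewrite unit6_vec vec6E unit6_vec vec6E.
move: (f (u 0)) (f (u 1)) (f (u 4)) hx hy hz => x y z hx hy hz y1 z4.
rewrite (homogE hx) (homogE hy) (homogE hz) !famE /fam_coord.
have coord_eq k v w : v = w :> 'rV[fps K]_(4 + 2) -> v`#k = w`#k by move->.
move=> Ey Ez; have := coord_eq 4 _ _ Ez; have := coord_eq 1 _ _ Ey.
have := coord_eq 0 _ _ Ey; rewrite scaleE6 !vec6E => y0.
rewrite y0 => /eqP; rewrite -subr_eq0 => /eqP y1E.
have x0 : 1 - x`#0 = 0.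
  apply: (@fps_mul_eq0 _ y`#1); first by rewrite y1 oner_eq0.
  by rewrite -[RHS]y1E; ring.
have -> : x`#0 = 1 by apply/eqP; rewrite eq_sym -subr_eq0 x0.
move=> /eqP; rewrite -subr_eq0 => /eqP z4E.
have : fps_X K = 0.
  apply: (@fps_mul_eq0 _ z`#4); first by rewrite z4 oner_eq0.
  by rewrite -[RHS]z4E; ring.
move=> /(congr1 (fun q : fps K => q 1%N)); rewrite /= coefX => /eqP.
by rewrite oner_eq0.
Qed.

Lemma shift_smooth : lam != 0 ->
  smooth_deformation_to shift_deformation (@g42_2 K) lam.
Proof.
move=> lam0; split; last first.
  exists (fun t => lam + t); split; last first.
    by near=> t; rewrite shift_at; exists idfun; split=> //; exists id.
  rewrite -[X in (_ --> X)%classic]addr0; apply: cvgD; first exact: cvg_cst.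
  exact: nbhs_dnbhs.
(* On this disc lam + t and lam + v are never opposite: otherwise 2 lam = - (t + v), of modulus less
   than 2 |lam|. *)
exists [set t | `|t| < `|lam|]%classic.
  by apply: (@dnbhs0_lt K K); rewrite normr_gt0.
split=> [t _|t v /= ht hv tv]; first by rewrite shiftE; exact: fam_cvg.
rewrite !shift_at => /g42_2_iso[/addrI //|/eqP].
rewrite -subr_eq0 opprK => /eqP E.
have lamE : lam + lam = - (t + v) by rewrite -[LHS]subr0 -E; ring.
have : `|lam + lam| < `|lam| + `|lam|.
  by rewrite lamE normrN (Order.POrderTheory.le_lt_trans (ler_normD _ _)) // ltrD.
by rewrite -mulr2n normrMn mulr2n Order.POrderTheory.ltxx.
Unshelve. all: by end_near.
Qed.

End Shift.

(** * The jump deformations at lambda = 1/2 and lambda = - 1/2 *)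

(** One straight path serves for both jumps: c = 0 leads to g_{4|2}^3 and c = 1 to osp(1,2) + C. For
    lam = - 1/2 it runs in the parameters a', b', with signs that [fam_swap_iso] undoes. *)
Lemma half_deformation (K : numFieldType) (lam c : K) :
  lam = 2^-1 \/ lam = - 2^-1 ->
  exists2 D : bracket (fps K) 4 2, metric_deformation (g42_2 lam) D &
    forall t, deformation_cvg D t /\
              lie_iso (deformation_at D t) (fam 1 2^-1 t (c * t) 0 0).
Proof.
have half : 2^-1 + 2^-1 = 1 :> K by rewrite -div1r -splitr.
pose P := @fps_of_poly K.
have P0 : P 0 = 0 by exact: rmorph0.
have P1 : P 1 = 1 by exact: rmorph1.
have Phalf : P (2^-1)%:P + P (2^-1)%:P = 1 by rewrite -P1 -raddfD -polyCD half.
case=> ->.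
  exists (fam (P 1) (P (2^-1)%:P) (P 'X) (P (c *: 'X)) (P 0) (P 0)).
    rewrite g42_2E P1 P0.
    have /fam_metric_deformation : fam_lie_cond 1 (P (2^-1)%:P) (P 'X) (P (c *: 'X)) 0 0.
      by constructor 2; rewrite Phalf.
    by rewrite /= coefC coefX coefZ coefX mulr0.
  move=> t; split; first exact: fam_cvg.
  by rewrite fam_at !hornerE; exists idfun; split=> //; exists id.
exists (fam (P 1) (P (- 2^-1)%:P) (P 0) (P 0) (P (- 'X)) (P (- (c *: 'X)))).
  rewrite g42_2E P1 P0.
  have /fam_metric_deformation :
      fam_lie_cond 1 (P (- 2^-1)%:P) 0 0 (P (- 'X)) (P (- (c *: 'X))).
    by constructor 3; rewrite polyCN /P !raddfN /= -opprD opprK Phalf.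
  by rewrite /= !coefN coefC coefX coefZ coefX mulr0 oppr0.
move=> t; split; first exact: fam_cvg.
rewrite fam_at !hornerE.
have := fam_swap_iso 1 (- 2^-1) 0 0 (- t) (- (c * t)).
by rewrite !opprK oppr0.
Qed.

Section SmoothAndJump.
Variable K : numFieldType.

Lemma shift_unique (lam : K) : lam != 0 -> lam != 2^-1 -> lam != - 2^-1 ->
  unique_metric_deformation (g42_2 lam) (shift_deformation lam).
Proof.
move=> lam0 lamp lamn; split; [exact: shift_metric | exact: shift_nontrivial | ].
move=> D D_metric D_nontriv.
have [nu nu0 Dnu] := metric_deformation_g42_2 lam0 lamp lamn D_metric.
exists (nu - fps_const lam); split; first by rewrite fps_coefB nu0 subrr.
  apply/eqP => /eqP; rewrite subr_eq0 => /eqP nuE.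
  by apply: D_nontriv; rewrite /trivial_deformation const_deformation_g42_2 -nuE.
rewrite /shift_deformation change_param_g42_2; last by rewrite fps_coefB nu0 subrr.
by rewrite addrC subrK; exact: Dnu.
Qed.

Lemma half_jump_g42_3 (lam : K) : lam = 2^-1 \/ lam = - 2^-1 ->
  exists D : bracket (fps K) 4 2, metric_deformation (g42_2 lam) D /\
    jump_deformation (g42_2 lam) D (g42_3 K).
Proof.
move=> /(half_deformation 0)[D D_metric D_at]; exists D; split=> //.
split; first exact: g42_2_not_iso_g42_3.
near=> t; have [D_cvg D_iso] := D_at t; split=> //.
apply: lie_iso_trans D_iso _; rewrite mul0r; apply: fam_g42_3_iso.
by near: t; exact: nbhs_dnbhs_neq.
Unshelve. all: by end_near.
Qed.

Lemma half_jump_osp (lam : K) : lam = 2^-1 \/ lam = - 2^-1 ->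
  exists D : bracket (fps K) 4 2, metric_deformation (g42_2 lam) D /\
    jump_deformation (g42_2 lam) D (lie_dsum (osp12 K) (abelian_lie K 1 0)).
Proof.
have two0 : 2 != 0 :> K by rewrite pnatr_eq0.
move=> /(half_deformation 1)[D D_metric D_at]; exists D; split=> //.
split; first exact: g42_2_not_iso_osp.
near=> t; have [D_cvg D_iso] := D_at t; split=> //.
apply: lie_iso_trans D_iso _; rewrite mul1r; apply: fam_osp_iso => //.
by near: t; exact: nbhs_dnbhs_neq.
Unshelve. all: by end_near.
Qed.

End SmoothAndJump.

Theorem theorem3p3p2 (R : realType) :
  (forall lam : R[i], lam != 0 -> lam != 2^-1 -> lam != - 2^-1 ->
     exists D : bracket (fps R[i]) 4 2,
       unique_metric_deformation (g42_2 lam) D /\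
       smooth_deformation_to D (@g42_2 R[i]) lam)
  /\
  (lie_iso (g42_2 (2^-1 : R[i])) (g42_2 (- 2^-1 : R[i])) /\
   forall lam : R[i], lam = 2^-1 \/ lam = - 2^-1 ->
     [/\ exists D : bracket (fps R[i]) 4 2,
           metric_deformation (g42_2 lam) D /\
           smooth_deformation_to D (@g42_2 R[i]) lam,
         exists D : bracket (fps R[i]) 4 2,
           metric_deformation (g42_2 lam) D /\
           jump_deformation (g42_2 lam) D (g42_3 R[i])
       & exists D : bracket (fps R[i]) 4 2,
           metric_deformation (g42_2 lam) D /\
           jump_deformation (g42_2 lam) D
             (lie_dsum (osp12 R[i]) (abelian_lie R[i] 1 0))]).
Proof.
split=> [lam lam0 lamp lamn|].
  by exists (shift_deformation lam); split; [exact: shift_unique | exact: shift_smooth].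
split.
  by rewrite !g42_2E -[X in fam 1 (- _) X X X X]oppr0; exact: fam_swap_iso.
move=> lam lamE; split; [|exact: half_jump_g42_3|exact: half_jump_osp].
exists (shift_deformation lam); split; first exact: shift_metric.
apply: shift_smooth; case: lamE => ->; rewrite ?oppr_eq0 invr_eq0 pnatr_eq0 //.
Qed.
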